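(* Let $f$ be a slice regular function defined on a symmetric domain $\Omega_D$ and let $q_0\in\Omega_D\setminus\mathbb{R}$; assume that $f$ admits a factorization on the sphere $\mathbb{S}_{q_0}$ of the type used to define its multiplicities there. Let $n\ge0$ be an integer such that $$\big((\partial_c\partial_s)^k f\big)(q_0)=\big(\partial_s(\partial_c\partial_s)^k f\big)(q_0)=0\quad\text{for all }k=0,\dots,n-1,$$ and such that $\big((\partial_c\partial_s)^n f\big)(q_0)\ne0$ or $\big(\partial_s(\partial_c\partial_s)^n f\big)(q_0)\neq0$. Then $2n$ is the spherical multiplicity of $f$ at $\mathbb{S}_{q_0}$. Moreover, $q_0$ has a positive isolated multiplicity if and only if $\big((\partial_c\partial_s)^n f\big)(q_0)=0$.
   Context: Quaternions: $\mathbb{H}$ is the algebra of quaternions, $x^c=\bar x$ the conjugate of $x$, $\operatorname{Re}(x)=(x+x^c)/2$, $\operatorname{Im}(x)=(x-x^c)/2$ (a purely imaginary quaternion), $\mathbb{S}=\{x\in\mathbb{H}: x^2=-1\}$. Every $x\in\mathbb{H}$ is $x=\alpha+I\beta$ with $\alpha,\beta\in\mathbb{R}$, $\beta\ge0$, $I\in\mathbb{S}$. Symmetric domains and slice functions: let $D\subset\mathbb{C}$ be open with $D=\overline{D}$ (invariant under complex conjugation; it may be disconnected, e.g. $D=\mathbb{C}\setminus\mathbb{R}$). Its circularization $\Omega_D=\{\alpha+I\beta: \alpha+i\beta\in D,\ I\in\mathbb{S}\}$ is called a symmetric domain. A stem function is $F=F_0+\sqrt{-1}F_1:D\to\mathbb{H}\otimes\mathbb{C}$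 with $F_0,F_1:D\to\mathbb{H}$, $F_0(\bar z)=F_0(z)$, $F_1(\bar z)=-F_1(z)$. It induces the slice function $f=\mathcal{I}(F):\Omega_D\to\mathbb{H}$, $f(\alpha+I\beta)=F_0(\alpha+i\beta)+I F_1(\alpha+i\beta)$. $f$ is slice regular if $F$ is $C^1$ and holomorphic, i.e. $\partial_\alpha F_0=\partial_\beta F_1$ and $\partial_\beta F_0=-\partial_\alpha F_1$. The slice product of $f=\mathcal{I}(F)$ and $g=\mathcal{I}(G)$ is $f\cdot g=\mathcal{I}(FG)$, where $FG=(F_0G_0-F_1G_1)+\sqrt{-1}(F_0G_1+F_1G_0)$. Operators: for a slice function $f=\mathcal{I}(F)$, the spherical derivative is the slice function on $\Omega_D\setminus\mathbb{R}$ given by $(\partial_s f)(x)=(2\operatorname{Im}(x))^{-1}(f(x)-f(x^c))=F_1(\alpha+i\beta)/\beta$; if $F$ is $C^1$, the slice derivative is $\partial_c f=\mathcal{I}(\partial F/\partial z)$, i.e. $(\partial_c f)(\alpha+I\beta)=\frac12\left(\frac{\partial}{\partial\alpha}-I\frac{\partial}{\partial\beta}\right)(F_0+IF_1)(\alpha+i\beta)$. Powers denote iterated composition (exponent $0$ is the identity). Multiplicities: for $q_0=\alpha_0+I_0\beta_0\in\mathbb{H}\setminus\mathbb{R}$ let $\mathbb{S}_{q_0}=\{\alpha_0+I\beta_0:I\in\mathbb{S}\}$ and $\Delta_{q_0}(x)=x^2-2x\operatorname{Re}(q_0)+|q_0|^2$. Suppose that there are integers $m,N\ge0$, points $q_1,\dots,q_N\in\mathbb{S}_{q_0}$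 with $q_i\ne\bar q_{i+1}$ for $i=1,\dots,N-1$, and a slice regular $g:\Omega_D\to\mathbb{H}$ without zeros in $\mathbb{S}_{q_0}$ such that $$f(x)=\Delta_{q_0}^m(x)(x-q_1)\cdot(x-q_2)\cdot\ldots\cdot(x-q_N)\cdot g(x).$$ Then $2m$ is called the spherical multiplicity of $f$ at $\mathbb{S}_{q_0}$ and $N$ the isolated multiplicity of $q_1$; points of $\mathbb{S}_{q_0}$ other than $q_1$ have isolated multiplicity $0$ (as do all points of $\mathbb{S}_{q_0}$ if $N=0$). *)

(* Defs.v *)
From Stdlib Require Import Reals Lra List.
From Coquelicot Require Import Coquelicot.
Import ListNotations.
Set Implicit Arguments.
Open Scope R_scope.

Record quat := Quat { qr : R; qi : R; qj : R; qk : R }.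

Declare Scope quat_scope.
Delimit Scope quat_scope with Q.
Bind Scope quat_scope with quat.

Definition qreal (a : R) : quat := Quat a 0 0 0.
Definition qunit_i : quat := Quat 0 1 0 0.

Definition qadd (x y : quat) : quat :=
  Quat (qr x + qr y) (qi x + qi y) (qj x + qj y) (qk x + qk y).
Definition qopp (x : quat) : quat := Quat (- qr x) (- qi x) (- qj x) (- qk x).
Definition qsub (x y : quat) : quat := qadd x (qopp y).
Definition qmul (x y : quat) : quat :=
  Quat (qr x * qr y - qi x * qi y - qj x * qj y - qk x * qk y)
       (qr x * qi y + qi x * qr y + qj x * qk y - qk x * qj y)
       (qr x * qj y - qi x * qk y + qj x * qr y + qk x * qi y)
       (qr x * qk y + qi x * qj y - qj x * qi y + qk x * qr y).

Notation "x + y" := (qadd x y) : quat_scope.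
Notation "- x" := (qopp x) : quat_scope.
Notation "x - y" := (qsub x y) : quat_scope.
Notation "x * y" := (qmul x y) : quat_scope.

Definition qscal (a : R) (x : quat) : quat :=
  Quat (a * qr x) (a * qi x) (a * qj x) (a * qk x).
Definition qconj (x : quat) : quat := Quat (qr x) (- qi x) (- qj x) (- qk x).
Definition qnorm2 (x : quat) : R :=
  qr x * qr x + qi x * qi x + qj x * qj x + qk x * qk x.
Definition qnorm (x : quat) : R := sqrt (qnorm2 x).
(* With Stdlib's total division, [qinv (qreal 0) = qreal 0]. *)
Definition qinv (x : quat) : quat := qscal (/ qnorm2 x) (qconj x).
Fixpoint qpow (x : quat) (n : nat) : quat :=
  match n with O => qreal 1 | S p => (x * qpow x p)%Q end.

Definition qRe (x : quat) : quat := qscal (/ 2) (x + qconj x)%Q.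
Definition qIm (x : quat) : quat := qscal (/ 2) (x - qconj x)%Q.

Definition is_real (x : quat) : Prop := exists a : R, x = qreal a.
Definition imag_unit (I : quat) : Prop := (I * I)%Q = qreal (-1).

(* The quaternion alpha + I beta, for z = alpha + i beta. *)
Definition on_slice (I : quat) (z : C) : quat :=
  (qreal (fst z) + I * qreal (snd z))%Q.

(* Polar data of x = alpha + I beta with beta >= 0.  For real x the choice of
   I is immaterial. *)
Definition qz (x : quat) : C := (qr x, qnorm (qIm x)).
Definition qdir (x : quat) : quat :=
  if Req_EM_T (qnorm (qIm x)) 0 then qunit_i
  else qscal (/ qnorm (qIm x)) (qIm x).

Definition symmetric_open (D : C -> Prop) : Prop :=
  open D /\ forall z, D z <-> D (Cconj z).

Definition circularization (D : C -> Prop) (x : quat) : Prop :=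
  exists (z : C) (I : quat), D z /\ imag_unit I /\ x = on_slice I z.

(* The complexified quaternions: (a, b) stands for a + sqrt(-1) b. *)
Definition quatC : Type := (quat * quat)%type.
Definition quatC_mul (u v : quatC) : quatC :=
  ((fst u * fst v - snd u * snd v)%Q, (fst u * snd v + snd u * fst v)%Q).

Definition is_stem (D : C -> Prop) (F : C -> quatC) : Prop :=
  forall z, D z ->
    fst (F (Cconj z)) = fst (F z) /\ snd (F (Cconj z)) = (- snd (F z))%Q.

Definition slice (F : C -> quatC) (x : quat) : quat :=
  (fst (F (qz x)) + qdir x * snd (F (qz x)))%Q.

(* The stem function that induces a given slice function; see [stem_ofP]. *)
Definition stem_of (f : quat -> quat) (z : C) : quatC :=
  let fp := f (on_slice qunit_i z) in
  let fm := f (on_slice qunit_i (Cconj z)) in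
  (qscal (/ 2) (fp + fm)%Q, qscal (/ 2) (- (qunit_i * (fp - fm)))%Q).

Definition qDerive (h : R -> quat) (t : R) : quat :=
  Quat (Derive (fun s => qr (h s)) t) (Derive (fun s => qi (h s)) t)
       (Derive (fun s => qj (h s)) t) (Derive (fun s => qk (h s)) t).
Definition d_alpha (F : C -> quat) (z : C) : quat :=
  qDerive (fun a => F (a, snd z)) (fst z).
Definition d_beta (F : C -> quat) (z : C) : quat :=
  qDerive (fun b => F (fst z, b)) (snd z).

Definition C1_real (D : C -> Prop) (u : C -> R) : Prop :=
  forall z : C, D z ->
    ex_derive (fun a => u (a, snd z)) (fst z) /\
    ex_derive (fun b => u (fst z, b)) (snd z) /\
    continuous (fun w : C => Derive (fun a => u (a, snd w)) (fst w)) z /\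
    continuous (fun w : C => Derive (fun b => u (fst w, b)) (snd w)) z.
Definition C1_quat (D : C -> Prop) (F : C -> quat) : Prop :=
  C1_real D (fun z => qr (F z)) /\ C1_real D (fun z => qi (F z)) /\
  C1_real D (fun z => qj (F z)) /\ C1_real D (fun z => qk (F z)).

Definition holomorphic_stem (D : C -> Prop) (F : C -> quatC) : Prop :=
  let F0 z := fst (F z) in
  let F1 z := snd (F z) in
  C1_quat D F0 /\ C1_quat D F1 /\
  forall z, D z ->
    d_alpha F0 z = d_beta F1 z /\ d_beta F0 z = (- d_alpha F1 z)%Q.

(* Functions on Omega_D are total functions on [quat] of which only the values
   on Omega_D matter. *)
Definition slice_regular (D : C -> Prop) (f : quat -> quat) : Prop :=
  exists F : C -> quatC,
    is_stem D F /\ holomorphic_stem D F /\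
    forall x, circularization D x -> f x = slice F x.

Definition slice_mul (f g : quat -> quat) : quat -> quat :=
  slice (fun z => quatC_mul (stem_of f z) (stem_of g z)).

Definition spherical_derivative (f : quat -> quat) (x : quat) : quat :=
  (qinv (qscal 2 (qIm x)) * (f x - f (qconj x)))%Q.

Definition d_z (F : C -> quatC) (z : C) : quatC :=
  let F0 w := fst (F w) in
  let F1 w := snd (F w) in
  (qscal (/ 2) (d_alpha F0 z + d_beta F1 z)%Q,
   qscal (/ 2) (d_alpha F1 z - d_beta F0 z)%Q).

Definition slice_derivative (f : quat -> quat) : quat -> quat :=
  slice (d_z (stem_of f)).

Definition dcs_iter (k : nat) (f : quat -> quat) : quat -> quat :=
  Nat.iter k (fun h => slice_derivative (spherical_derivative h)) f.

Definition sphere (q x : quat) : Prop :=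
  exists I, imag_unit I /\ x = on_slice I (qz q).

Definition Delta (q x : quat) : quat :=
  (x * x - qscal 2 (x * qRe q) + qreal (qnorm q ^ 2))%Q.

(* (x - q_1) . ... . (x - q_N) . g, for slice products. *)
Definition linear_factors (qs : list quat) (g : quat -> quat) : quat -> quat :=
  fold_right (fun q h => slice_mul (fun x => (x - q)%Q) h) g qs.

Definition factorization (D : C -> Prop) (f : quat -> quat) (q0 : quat)
    (m : nat) (qs : list quat) (g : quat -> quat) : Prop :=
  (forall q, In q qs -> sphere q0 q) /\
  (forall i : nat, (S i < length qs)%nat ->
     nth i qs (qreal 0) <> qconj (nth (S i) qs (qreal 0))) /\
  slice_regular D g /\
  (forall x, sphere q0 x -> g x <> qreal 0) /\
  (forall x, circularization D x ->
     f x = (qpow (Delta q0 x) m * linear_factors qs g x)%Q).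

Definition spherical_multiplicity (D : C -> Prop) (f : quat -> quat)
    (q0 : quat) (s : nat) : Prop :=
  exists m qs g, factorization D f q0 m qs g /\ s = (2 * m)%nat.

(* Multiplicity k of the point q itself, read off a factorization on the sphere
   through q. *)
Definition isolated_multiplicity (D : C -> Prop) (f : quat -> quat)
    (q : quat) (k : nat) : Prop :=
  exists m qs g, factorization D f q m qs g /\
    ((hd_error qs = Some q /\ k = length qs) \/
     (hd_error qs <> Some q /\ k = 0%nat)).

Lemma quat_ext (x y : quat) :
  qr x = qr y -> qi x = qi y -> qj x = qj y -> qk x = qk y -> x = y.
Proof. destruct x, y; simpl; intros; subst; reflexivity. Qed.

Lemma qIm_E (x : quat) : qIm x = Quat 0 (qi x) (qj x) (qk x).
Proof. apply quat_ext; simpl; field. Qed.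

Lemma imag_unit_coords (I : quat) : imag_unit I ->
  qr I = 0 /\ qi I * qi I + qj I * qj I + qk I * qk I = 1.
Proof.
destruct I as [a b c d]; unfold imag_unit, qreal; simpl.
intros H; injection H as H0 H1 H2 H3.
assert (a = 0); [|subst; split; lra].
destruct (Req_dec a 0) as [|Ha]; [assumption|exfalso].
assert (b = 0) by (apply (Rmult_eq_reg_l a); lra).
assert (c = 0) by (apply (Rmult_eq_reg_l a); lra).
assert (d = 0) by (apply (Rmult_eq_reg_l a); lra).
subst. pose proof (Rle_0_sqr a) as Hs; unfold Rsqr in Hs; lra.
Qed.

Lemma slice_on_slice (D : C -> Prop) (F : C -> quatC) (I : quat) (z : C) :
  is_stem D F -> D z -> imag_unit I ->
  slice F (on_slice I z) = (fst (F z) + I * snd (F z))%Q.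
Proof.
intros HF Dz HI; destruct (imag_unit_coords HI) as [I0 I1]; clear HI.
destruct z as [a b], I as [r p s t]; simpl in I0, I1; subst r.
assert (E : on_slice (Quat 0 p s t) (a, b) = Quat a (p * b) (s * b) (t * b)).
{ apply quat_ext; simpl; ring. }
assert (N : qnorm (qIm (Quat a (p * b) (s * b) (t * b))) = Rabs b).
{ rewrite qIm_E; unfold qnorm, qnorm2; simpl.
  rewrite <- sqrt_Rsqr_abs; f_equal; unfold Rsqr.
  replace (b * b) with ((p * p + s * s + t * t) * (b * b)) by (rewrite I1; ring).
  ring. }
unfold slice, qdir, qz; rewrite E, N, qIm_E; simpl.
destruct (HF _ Dz) as [H0 H1]; unfold Cconj in H0, H1; simpl in H0, H1.
destruct (Req_EM_T (Rabs b) 0) as [Hb|Hb].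
- assert (b = 0) by (destruct (Req_dec b 0) as [|Hn]; [assumption|];
    exfalso; exact (Rabs_no_R0 b Hn Hb)).
  subst b; rewrite Rabs_R0; rewrite Ropp_0 in H1.
  destruct (snd (F (a, 0))) as [u v w y]; injection H1 as K0 K1 K2 K3.
  replace u with 0 by lra; replace v with 0 by lra;
  replace w with 0 by lra; replace y with 0 by lra.
  apply quat_ext; simpl; ring.
- assert (Nb : b <> 0) by (intros ->; apply Hb, Rabs_R0).
  destruct (Rle_or_lt 0 b) as [Pb|Pb].
  + rewrite (Rabs_pos_eq _ Pb); apply quat_ext; simpl; field; assumption.
  + rewrite (Rabs_left _ Pb), H0, H1; apply quat_ext; simpl; field; lra.
Qed.

Lemma imag_unit_i : imag_unit qunit_i.
Proof. apply quat_ext; simpl; ring. Qed.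

Lemma stem_ofP (D : C -> Prop) (F : C -> quatC) (f : quat -> quat) (z : C) :
  symmetric_open D -> is_stem D F ->
  (forall x, circularization D x -> f x = slice F x) ->
  D z -> stem_of f z = F z.
Proof.
intros [_ HD] HF Hf Dz; unfold stem_of.
pose proof (proj1 (HD z) Dz) as Dz'.
assert (Hi : forall w, D w ->
  f (on_slice qunit_i w) = (fst (F w) + qunit_i * snd (F w))%Q).
{ intros w Dw; rewrite Hf.
  - exact (slice_on_slice _ HF Dw imag_unit_i).
  - exists w, qunit_i; exact (conj Dw (conj imag_unit_i eq_refl)). }
rewrite (Hi z Dz), (Hi _ Dz').
destruct (HF _ Dz) as [-> ->].
destruct (F z) as [u v]; simpl; f_equal; apply quat_ext; simpl; field.
Qed.

(* Main.v *)
Require Import Defs.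
From Stdlib Require Import Reals Lra Lia List Factorial.
From Coquelicot Require Import Coquelicot.

(** Write [T] for the operator that [slice_derivative \o spherical_derivative]
    induces on stem functions: on each of the four complex components [F] it is
    [d/dz (Im F / beta)].  If [F] agrees with [c (z - z0)^(p+1)] up to terms of
    order [p + 2] at [z0], then [T F] agrees with
    [c (p + 1) / (2 i beta0) (z - z0)^p] up to order [p + 1].  Near [z0] the stem of [f] is
    [((z - z0) (z - conj z0))^m H], where [H] is the stem of the remaining factors, so
    [T^k] of it vanishes at [z0] for [k < m] and [T^m] of it takes the value
    [m! H(z0)].  The condition on consecutive [q_i] makes [H(z0)] nonzero, with
    [H] vanishing on the sphere exactly at [q_1].

    Iterating [T] requires all partial derivatives of a stem that is
    only assumed C1; they come from the Cauchy formula on a circle. *)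

(** * Complex-valued curves and integrals over a circle *)

(** Orders of vanishing are therefore counted with real partial derivatives, which survive [Im] and
    division by [beta]. Only the leading monomial is complex; the remainder may be any smooth
    function of higher order.

    [T] and the stem of the power of [Delta] involve only real scalars, partial derivatives and the
    central [sqrt(-1)], so they act separately on the four coordinates. Noncommutativity is confined
    to the linear factors, of which just the smoothness and the value at [z0] are used.

    The bare factor [m!] arises by cancellation: [m] denominators [2 i beta0] from [T] meet [m]
    values [z0 - conj z0 = 2 i beta0].

    The two conditions at [q0] say together that the stem vanishes at [z0]: the spherical derivative
    kills [F1], and the value then kills [F0]. So the first index where they fail is the exponent of
    every factorization, which gives uniqueness of the spherical multiplicity. *)

Definition cderive (h : R -> C) (t : R) (l : C) : Prop :=
  is_derive (fun s => Re (h s)) t (Re l) /\ is_derive (fun s => Im (h s)) t (Im l).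

Lemma cderive_eq (h : R -> C) (t : R) (l l' : C) :
  cderive h t l -> l = l' -> cderive h t l'.
Proof. intros H <-; exact H. Qed.

Lemma cderive_ext_loc (h k : R -> C) (t : R) (l : C) :
  locally t (fun s => h s = k s) -> cderive h t l -> cderive k t l.
Proof.
intros E [H1 H2]; split;
  [apply (is_derive_ext_loc (fun s => Re (h s))) | apply (is_derive_ext_loc (fun s => Im (h s)))];
  try assumption; apply filter_imp with (2 := E); intros s ->; reflexivity.
Qed.

Lemma cderive_ext (h k : R -> C) (t : R) (l : C) :
  (forall s, h s = k s) -> cderive h t l -> cderive k t l.
Proof. intros E; apply cderive_ext_loc, filter_forall, E. Qed.

Lemma cderive_const (a : C) (t : R) : cderive (fun _ => a) t 0%C.
Proof. split; exact (is_derive_const _ t). Qed.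

Lemma cderive_plus (h k : R -> C) (t : R) (a b : C) :
  cderive h t a -> cderive k t b -> cderive (fun s => h s + k s)%C t (a + b)%C.
Proof.
intros [H1 H2] [K1 K2]; split;
  [exact (is_derive_plus _ _ _ _ _ H1 K1) | exact (is_derive_plus _ _ _ _ _ H2 K2)].
Qed.

Lemma cderive_mult (h k : R -> C) (t : R) (a b : C) :
  cderive h t a -> cderive k t b ->
  cderive (fun s => h s * k s)%C t (a * k t + h t * b)%C.
Proof.
assert (M : forall u v du dv, is_derive u t du -> is_derive v t dv ->
  is_derive (fun s => u s * v s) t (du * v t + u t * dv)).
{ intros u v du dv Hu Hv; exact (is_derive_mult _ _ _ _ _ Hu Hv Rmult_comm). }
intros [H1 H2] [K1 K2]; split.
- apply (is_derive_ext (fun s => Re (h s) * Re (k s) - Im (h s) * Im (k s)));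
    [reflexivity|].
  evar_last; [exact (is_derive_minus _ _ _ _ _ (M _ _ _ _ H1 K1) (M _ _ _ _ H2 K2))|].
  unfold minus, plus, opp, Re, Im; simpl; ring.
- apply (is_derive_ext (fun s => Re (h s) * Im (k s) + Im (h s) * Re (k s)));
    [reflexivity|].
  evar_last; [exact (is_derive_plus _ _ _ _ _ (M _ _ _ _ H1 K2) (M _ _ _ _ H2 K1))|].
  unfold plus, Re, Im; simpl; ring.
Qed.

Lemma Cnorm2_pos (z : C) : z <> 0%C -> 0 < Re z ^ 2 + Im z ^ 2.
Proof.
intros Hz; rewrite <- Cmod2_alt; apply pow_lt, Cmod_gt_0, Hz.
Qed.

Lemma cderive_inv (h : R -> C) (t : R) (a : C) :
  cderive h t a -> h t <> 0%C -> cderive (fun s => / h s)%C t (- a / (h t * h t))%C.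
Proof.
intros [H1 H2] Hn.
pose proof (Cnorm2_pos _ Hn) as P.
assert (N : is_derive (fun s => Re (h s) ^ 2 + Im (h s) ^ 2) t
  (2 * Re a * Re (h t) + 2 * Im a * Im (h t))).
{ evar_last; [exact (is_derive_plus _ _ _ _ _ (is_derive_pow _ 2 _ _ H1) (is_derive_pow _ 2 _ _ H2))|].
  unfold plus; simpl; ring. }
split.
- evar_last; [exact (is_derive_div _ _ _ _ _ H1 N (Rgt_not_eq _ _ P))|].
  unfold Cdiv, Cinv, Cmult, Copp, Re, Im in *; simpl in *; field.
  split; nra.
- evar_last; [exact (is_derive_div _ _ _ _ _ (is_derive_opp _ _ _ H2) N (Rgt_not_eq _ _ P))|].
  unfold Cdiv, Cinv, Cmult, Copp, opp, Re, Im in *; simpl in *; field.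
  split; nra.
Qed.

(** Joint continuity of both parts, the form in which differentiation under the integral sign asks
    for it. *)
Definition ccont2 (P : R -> R -> C) (s t : R) : Prop :=
  continuity_2d_pt (fun u v => Re (P u v)) s t /\
  continuity_2d_pt (fun u v => Im (P u v)) s t.

Lemma ccont2_ext (P Q : R -> R -> C) (s t : R) :
  (forall u v, P u v = Q u v) -> ccont2 P s t -> ccont2 Q s t.
Proof.
intros E [H1 H2]; split; [eapply continuity_2d_pt_ext with (2 := H1) |
  eapply continuity_2d_pt_ext with (2 := H2)]; intros u v; simpl; rewrite E; reflexivity.
Qed.

Lemma ccont2_const (a : C) (s t : R) : ccont2 (fun _ _ => a) s t.
Proof. split; apply continuity_2d_pt_const. Qed.

Lemma ccont2_plus (P Q : R -> R -> C) (s t : R) :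
  ccont2 P s t -> ccont2 Q s t -> ccont2 (fun u v => P u v + Q u v)%C s t.
Proof.
intros [P1 P2] [Q1 Q2]; split;
  [exact (continuity_2d_pt_plus _ _ _ _ P1 Q1) | exact (continuity_2d_pt_plus _ _ _ _ P2 Q2)].
Qed.

Lemma ccont2_mult (P Q : R -> R -> C) (s t : R) :
  ccont2 P s t -> ccont2 Q s t -> ccont2 (fun u v => P u v * Q u v)%C s t.
Proof.
intros [P1 P2] [Q1 Q2]; split.
- exact (continuity_2d_pt_minus _ _ _ _
    (continuity_2d_pt_mult _ _ _ _ P1 Q1) (continuity_2d_pt_mult _ _ _ _ P2 Q2)).
- exact (continuity_2d_pt_plus _ _ _ _
    (continuity_2d_pt_mult _ _ _ _ P1 Q2) (continuity_2d_pt_mult _ _ _ _ P2 Q1)).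
Qed.

Lemma ccont2_inv (P : R -> R -> C) (s t : R) :
  ccont2 P s t -> P s t <> 0%C -> ccont2 (fun u v => / P u v)%C s t.
Proof.
intros [P1 P2] Hn; pose proof (Cnorm2_pos _ Hn) as Hp.
assert (N : continuity_2d_pt (fun u v => / (Re (P u v) ^ 2 + Im (P u v) ^ 2)) s t).
{ apply continuity_2d_pt_inv; [|lra].
  apply (continuity_2d_pt_ext (fun u v => Re (P u v) * Re (P u v) + Im (P u v) * Im (P u v)));
    [intros; ring|].
  apply continuity_2d_pt_plus; apply continuity_2d_pt_mult; assumption. }
split.
- exact (continuity_2d_pt_mult _ _ _ _ P1 N).
- exact (continuity_2d_pt_mult _ _ _ _ (continuity_2d_pt_opp _ _ _ P2) N).
Qed.

Lemma ccont2_pow (P : R -> R -> C) (n : nat) (s t : R) :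
  ccont2 P s t -> ccont2 (fun u v => P u v ^ n)%C s t.
Proof.
intros H; induction n as [|n IH]; simpl; [apply ccont2_const|].
now apply ccont2_mult.
Qed.

Lemma ccont2_fst (h : R -> R) (s t : R) :
  continuity_pt h s -> ccont2 (fun u _ => RtoC (h u)) s t.
Proof.
intros H; split; simpl; [|apply continuity_2d_pt_const].
apply (continuity_1d_2d_pt_comp h (fun u _ => u)); [exact H|apply continuity_2d_pt_id1].
Qed.

Lemma ccont2_snd (h : R -> C) (s t : R) :
  continuity_pt (fun v => Re (h v)) t -> continuity_pt (fun v => Im (h v)) t ->
  ccont2 (fun _ v => h v) s t.
Proof.
intros H1 H2; split;
  [apply (continuity_1d_2d_pt_comp (fun v => Re (h v)) (fun _ v => v)) |
   apply (continuity_1d_2d_pt_comp (fun v => Im (h v)) (fun _ v => v))];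
  try assumption; apply continuity_2d_pt_id2.
Qed.

Lemma continuity_2d_pt_comp (u : C -> R) (P : R -> R -> C) (s t : R) :
  continuous u (P s t) -> ccont2 P s t -> continuity_2d_pt (fun a b => u (P a b)) s t.
Proof.
intros Hu [P1 P2].
apply continuity_2d_pt_filterlim in P1; apply continuity_2d_pt_filterlim in P2.
apply continuity_2d_pt_filterlim.
apply (filterlim_comp _ _ _ (fun z : R * R => P (fst z) (snd z)) u _ (locally (P s t)));
  [|exact Hu].
intros A [e HA]; change (locally (s, t) (fun z : R * R => A (P (fst z) (snd z)))).
pose proof (P1 _ (locally_ball (Re (P s t)) e)) as L1.
pose proof (P2 _ (locally_ball (Im (P s t)) e)) as L2.
unfold filtermap in L1, L2; apply filter_imp with (2 := filter_and _ _ L1 L2).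
intros z [B1 B2]; apply HA; split; assumption.
Qed.

Lemma continuity_2d_pt_section (h : R -> R -> R) (s t : R) :
  continuity_2d_pt h s t -> continuity_pt (h s) t.
Proof.
intros H; apply continuity_pt_filterlim; intros A [e HA].
destruct (H e) as [d Hd].
exists d; intros v Hv; apply HA, Hd; [rewrite Rminus_eq_0, Rabs_R0; apply d | exact Hv].
Qed.

Lemma is_derive_RInt_interval (P dP : R -> R -> R) (a b l r s : R) :
  l < s < r ->
  (forall u v, l < u < r -> is_derive (fun x => P x v) u (dP u v)) ->
  (forall u v, l < u < r -> continuity_2d_pt dP u v) ->
  (forall u v, l < u < r -> continuity_2d_pt P u v) ->
  is_derive (fun u => RInt (P u) a b) s (RInt (dP s) a b).
Proof.
intros Hs Hd Hc HP.
assert (L : locally s (fun u => l < u < r)).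
{ apply (locally_interval _ s l r); simpl; intros; lra. }
rewrite (RInt_ext (dP s) (fun t => Derive (fun u => P u t) s)).
2:{ intros v _; symmetry; apply is_derive_unique, Hd, Hs. }
apply (is_derive_RInt_param (fun u v => P u v)).
- apply filter_imp with (2 := L); intros u Hu v _; exists (dP u v); apply Hd, Hu.
- intros v _. apply continuity_2d_pt_ext_loc with (f := dP); [|apply Hc, Hs].
  destruct L as [e He]; exists e; intros u w Hu _.
  symmetry; apply is_derive_unique, Hd, He, Hu.
- apply filter_imp with (2 := L); intros u Hu.
  apply (ex_RInt_continuous (V := R_CompleteNormedModule)); intros v _.
  apply continuity_pt_filterlim, continuity_2d_pt_section, HP, Hu.
Qed.

(** An integral over the angle, without a [dz]: integrands carry their own factor [r * cexpi t]. *)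
Definition CInt (h : R -> C) : C :=
  (RInt (fun t => Re (h t)) 0 (2 * PI), RInt (fun t => Im (h t)) 0 (2 * PI)).

Lemma CInt_ext (h k : R -> C) : (forall t, h t = k t) -> CInt h = CInt k.
Proof. intros E; unfold CInt; f_equal; apply RInt_ext; intros t _; now rewrite E. Qed.

Lemma cderive_CInt (P dP : R -> R -> C) (l r s : R) :
  l < s < r ->
  (forall u v, l < u < r -> cderive (fun x => P x v) u (dP u v)) ->
  (forall u v, l < u < r -> ccont2 dP u v) ->
  (forall u v, l < u < r -> ccont2 P u v) ->
  cderive (fun u => CInt (P u)) s (CInt (dP s)).
Proof.
intros Hs Hd Hc HP; split; simpl.
- apply (is_derive_RInt_interval (fun u v => Re (P u v)) (fun u v => Re (dP u v)) _ _ l r);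
    try assumption; intros u v Hu; [apply (Hd u v Hu)|apply (Hc u v Hu)|apply (HP u v Hu)].
- apply (is_derive_RInt_interval (fun u v => Im (P u v)) (fun u v => Im (dP u v)) _ _ l r);
    try assumption; intros u v Hu; [apply (Hd u v Hu)|apply (Hc u v Hu)|apply (HP u v Hu)].
Qed.

Lemma CInt_derive (k dk : R -> C) :
  (forall t, cderive k t (dk t)) ->
  (forall t, continuity_pt (fun s => Re (dk s)) t /\ continuity_pt (fun s => Im (dk s)) t) ->
  k (2 * PI) = k 0 -> CInt dk = 0%C.
Proof.
intros Hd Hc Hp; unfold CInt.
assert (Z : forall u du : R -> R, (forall t, is_derive u t (du t)) ->
  (forall t, continuity_pt du t) -> u (2 * PI) = u 0 -> RInt du 0 (2 * PI) = 0).
{ intros u du Hu Hdu E; apply is_RInt_unique.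
  replace 0 with (minus (u (2 * PI)) (u 0)) at 2 by (rewrite E; exact (minus_eq_zero (u 0))).
  apply (is_RInt_derive u du); intros t _; [apply Hu|apply continuity_pt_filterlim, Hdu]. }
unfold RtoC; f_equal.
- apply (Z (fun t => Re (k t))); [apply Hd|apply Hc|now rewrite Hp].
- apply (Z (fun t => Im (k t))); [apply Hd|apply Hc|now rewrite Hp].
Qed.

Lemma cderive_zero_eq (h : R -> C) (a b : R) :
  a < b -> (forall t, a <= t <= b -> cderive h t 0%C) -> h b = h a.
Proof.
intros Hab H.
assert (Z : forall u : R -> R, (forall t, a <= t <= b -> is_derive u t 0) -> u b = u a).
{ intros u Hu.
  destruct (MVT_gen u a b (fun _ => 0)) as [c [_ E]]; [| |lra];
    rewrite Rmin_left, Rmax_right by lra; intros t Ht.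
  - apply Hu; lra.
  - apply continuity_pt_filterlim, (ex_derive_continuous u); exists 0; apply Hu, Ht. }
apply injective_projections; [apply (Z (fun t => Re (h t)))|apply (Z (fun t => Im (h t)))];
  intros t Ht; apply (H t Ht).
Qed.

(** The derivative of the integral in [u] is the integral over a full period of [dP u], which has
    the periodic primitive [K u], hence is zero. Exhibiting [K] replaces the usual exchange of
    second derivatives, so C1 data suffice. The margins around 0 and 1 make both endpoints
    interior. *)
Lemma CInt_homotopy (P dP K : R -> R -> C) (l r : R) :
  l < 0 -> 1 < r ->
  (forall u v, l < u < r -> cderive (fun x => P x v) u (dP u v)) ->
  (forall u v, l < u < r -> ccont2 dP u v) ->
  (forall u v, l < u < r -> ccont2 P u v) ->
  (forall u v, l < u < r -> cderive (K u) v (dP u v)) ->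
  (forall u, K u (2 * PI) = K u 0) ->
  CInt (P 1) = CInt (P 0).
Proof.
intros Hl Hr Hd Hc HP HK Hper.
apply (cderive_zero_eq (fun u => CInt (P u)) 0 1); [lra|]; intros u Hu.
assert (Hu' : l < u < r) by lra.
apply cderive_eq with (CInt (dP u)); [apply (cderive_CInt P dP l r); assumption|].
apply (CInt_derive (K u)); [intros v; now apply HK| |apply Hper].
intros v; destruct (Hc u v Hu') as [H1 H2]; split;
  [apply (continuity_2d_pt_section (fun a b => Re (dP a b))) |
   apply (continuity_2d_pt_section (fun a b => Im (dP a b)))]; assumption.
Qed.

(** * Cauchy's formula *)

Definition dx (u : C -> R) (z : C) : R := Derive (fun a => u (a, snd z)) (fst z).
Definition dy (u : C -> R) (z : C) : R := Derive (fun b => u (fst z, b)) (snd z).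

Lemma C1_real_differentiable (D : C -> Prop) (u : C -> R) (z : C) :
  open D -> C1_real D u -> D z ->
  differentiable_pt_lim (fun a b => u (a, b)) (fst z) (snd z) (dx u z) (dy u z).
Proof.
intros OD Hu Dz; apply filterdiff_differentiable_pt_lim.
apply (is_derive_filterdiff (fun a b => u (a, b)) (fst z) (snd z)
  (fun a b => dx u (a, b)) (dy u z)).
- rewrite <- surjective_pairing.
  apply filter_imp with (2 := OD z Dz); intros w Dw.
  apply (Derive_correct (fun a => u (a, snd w))), (Hu w Dw).
- apply (Derive_correct (fun b => u (fst z, b))), (Hu z Dz).
- rewrite <- surjective_pairing.
  apply (continuous_ext (dx u)); [intros w; now rewrite <- surjective_pairing|].
  apply (Hu z Dz).
Qed.

Lemma is_derive_comp_C1 (D : C -> Prop) (u : C -> R) (h : R -> C) (t : R) (l : C) :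
  open D -> C1_real D u -> D (h t) -> cderive h t l ->
  is_derive (fun s => u (h s)) t (dx u (h t) * Re l + dy u (h t) * Im l).
Proof.
intros OD Hu Dh [H1 H2].
apply is_derive_Reals in H1; apply is_derive_Reals in H2; apply is_derive_Reals.
pose proof (derivable_pt_lim_comp_2d _ _ _ _ _ _ _ _
  (C1_real_differentiable D u _ OD Hu Dh) H1 H2) as H.
apply is_derive_Reals in H; apply is_derive_Reals.
eapply is_derive_ext with (2 := H); intros s; simpl; now rewrite <- surjective_pairing.
Qed.

Lemma C1_real_ccont2 (D : C -> Prop) (u : C -> R) (P : R -> R -> C) (s t : R) :
  open D -> C1_real D u -> D (P s t) -> ccont2 P s t ->
  continuity_2d_pt (fun a b => u (P a b)) s t /\
  continuity_2d_pt (fun a b => dx u (P a b)) s t.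
Proof.
intros OD Hu DP HP; split; apply continuity_2d_pt_comp; try assumption.
- assert (H : continuity_2d_pt (fun a b => u (a, b)) (fst (P s t)) (snd (P s t))).
  { apply differentiable_continuity_pt.
    exists (dx u (P s t)), (dy u (P s t)); now apply C1_real_differentiable with D. }
  apply continuity_2d_pt_filterlim in H; rewrite <- surjective_pairing in H.
  apply (continuous_ext (fun w : C => u (fst w, snd w)));
    [|unfold continuous; rewrite <- surjective_pairing; exact H].
  intros w; now rewrite <- surjective_pairing.
- apply (Hu _ DP).
Qed.

(** Holomorphy in the form in which the homotopies use it: a chain rule along curves with a complex
    factor [dF], and continuity of [F] and [dF] along two-parameter families. *)
Definition holo (D : C -> Prop) (F dF : C -> C) : Prop :=
  (forall h t l, D (h t) -> cderive h t l ->
     cderive (fun s => F (h s)) t (dF (h t) * l)%C) /\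
  (forall P s t, D (P s t) -> ccont2 P s t ->
     ccont2 (fun a b => F (P a b)) s t /\ ccont2 (fun a b => dF (P a b)) s t).

Lemma Cauchy_Riemann_holo (D : C -> Prop) (u v : C -> R) :
  open D -> C1_real D u -> C1_real D v ->
  (forall z, D z -> dx u z = dy v z /\ dy u z = - dx v z) ->
  holo D (fun z => (u z, v z)) (fun z => (dx u z, dx v z)).
Proof.
intros OD Hu Hv CR; split.
- intros h t l Dh Hh; destruct (CR _ Dh) as [E1 E2]; split; simpl.
  + evar_last; [exact (is_derive_comp_C1 _ _ _ _ _ OD Hu Dh Hh)|].
    rewrite E2; unfold Re, Im; ring.
  + evar_last; [exact (is_derive_comp_C1 _ _ _ _ _ OD Hv Dh Hh)|].
    rewrite E1; unfold Re, Im; ring.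
- intros P s t DP HP.
  destruct (C1_real_ccont2 _ _ _ _ _ OD Hu DP HP), (C1_real_ccont2 _ _ _ _ _ OD Hv DP HP).
  now repeat split.
Qed.

Definition cexpi (t : R) : C := (cos t, sin t).

Lemma cderive_cexpi (t : R) : cderive cexpi t (Ci * cexpi t)%C.
Proof.
split; simpl.
- evar_last; [apply is_derive_cos|simpl; ring].
- evar_last; [apply is_derive_sin|simpl; ring].
Qed.

Lemma Cmod_cexpi (t : R) : Cmod (cexpi t) = 1.
Proof.
unfold Cmod; simpl; pose proof (sin2_cos2 t) as H; unfold Rsqr in H.
transitivity (sqrt 1); [f_equal; lra|apply sqrt_1].
Qed.

Lemma cexpi_2PI : cexpi (2 * PI) = cexpi 0.
Proof. unfold cexpi; now rewrite cos_2PI, sin_2PI, cos_0, sin_0. Qed.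

Lemma ccont2_cexpi (s t : R) : ccont2 (fun _ v => cexpi v) s t.
Proof. apply ccont2_snd; simpl; [apply continuity_cos|apply continuity_sin]. Qed.

Lemma ccont2_RtoC (s t : R) : ccont2 (fun u _ => RtoC u) s t.
Proof. apply (ccont2_fst (fun u => u)), continuity_pt_id. Qed.

Lemma cderive_RtoC (t : R) : cderive RtoC t 1%C.
Proof. split; simpl; [exact (is_derive_id t)|exact (is_derive_const _ t)]. Qed.

Lemma circle_minus_neq_0 (r : R) (W : C) (t : R) :
  0 < r -> Cmod W < r -> (r * cexpi t - W)%C <> 0%C.
Proof.
intros Hr HW E; assert (W = (r * cexpi t)%C) as EW by (rewrite <- (Cplus_0_l W), <- E; ring).
rewrite EW, Cmod_mult, Cmod_cexpi, Cmod_R, Rabs_pos_eq in HW; lra.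
Qed.

Lemma Ci_sqr : (Ci * Ci)%C = (- (1))%C.
Proof. apply injective_projections; simpl; ring. Qed.

Lemma CInt_const (a : C) : CInt (fun _ => a) = (2 * PI * a)%C.
Proof.
unfold CInt; rewrite !RInt_const; unfold scal; simpl; unfold mult; simpl.
apply injective_projections; simpl; unfold Re, Im; ring.
Qed.

Ltac ccont := repeat first [ apply ccont2_pow | apply ccont2_plus | apply ccont2_mult
  | apply ccont2_const
  | apply ccont2_cexpi | apply ccont2_RtoC ].

(* First move the integrand along the segments from the circle to [w], then
   shrink [W] to the centre in the kernel that remains. *)
Lemma Cauchy_formula (D : C -> Prop) (F dF : C -> C) (z0 W : C) (r : R) :
  holo D F dF -> 0 < r -> Cmod W < r / 2 ->
  (forall z, Cmod (z - z0) < 2 * r -> D z) ->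
  CInt (fun t => F (z0 + r * cexpi t) * (r * cexpi t * / (r * cexpi t - W)))%C
    = (2 * PI * F (z0 + W))%C.
Proof.
intros [HF HC] Hr HW HD.
assert (NZ : forall s t, -3/2 < s < 3/2 -> (r * cexpi t - s * W)%C <> 0%C).
{ intros s t Hs; apply circle_minus_neq_0; [lra|].
  rewrite Cmod_mult, Cmod_R; pose proof (Cmod_ge_0 W).
  assert (Rabs s < 2) by (apply Rabs_def1; lra); pose proof (Rabs_pos s); nra. }
assert (NZ1 : forall t, (r * cexpi t - W)%C <> 0%C).
{ intros t; apply circle_minus_neq_0; lra. }
(* The segment from [z0 + W], at [s = 0], to the point of the circle, at [s = 1]. *)
set (A := fun s t => (z0 + W + s * (r * cexpi t - W))%C).
(* The distance to [z0] is below [(5/4)(r/2) + (5/4) r = 15 r / 8], which fits into the disc of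
   radius [2 * r]. *)
assert (DA : forall s t, -1/4 < s < 5/4 -> D (A s t)).
{ intros s t Hs; apply HD; unfold A.
  replace (z0 + W + s * (r * cexpi t - W) - z0)%C with ((1 - s)%R * W + s * r * cexpi t)%C
    by (rewrite RtoC_minus; ring).
  eapply Rle_lt_trans; [apply Cmod_triangle|].
  rewrite !Cmod_mult, !Cmod_R, Cmod_cexpi, (Rabs_pos_eq r) by lra.
  pose proof (Cmod_ge_0 W).
  assert (Rabs s < 5/4) by (apply Rabs_def1; lra).
  assert (Rabs (1 - s) < 5/4) by (apply Rabs_def1; lra).
  assert (Rabs (1 - s) * Cmod W <= 5/4 * (r / 2))
    by (apply Rmult_le_compat; try lra; apply Rabs_pos).
  assert (Rabs s * r < 5/4 * r) by (apply Rmult_lt_compat_r; lra).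
  lra. }
assert (CA : forall s t, ccont2 A s t).
{ intros s t; unfold A, Cminus; ccont. }
assert (dA : forall s t, cderive (A s) t (s * r * (Ci * cexpi t))%C).
{ intros s t; eapply cderive_eq.
  - unfold A, Cminus; apply cderive_plus; [apply cderive_const|].
    apply cderive_mult; [apply cderive_const|].
    apply cderive_plus; [|apply cderive_const].
    apply cderive_mult; [apply cderive_const|apply cderive_cexpi].
  - simpl; ring. }
assert (S1 : CInt (fun t => F (A 1 t) * (r * cexpi t * / (r * cexpi t - W)))%C =
  CInt (fun t => F (A 0 t) * (r * cexpi t * / (r * cexpi t - W)))%C).
(* Differentiating in [s] produces the factor [r * cexpi t - W], which cancels the kernel. What is
   left is the [t]-derivative of [F (A s t) / (i s)]. This primitive is undefined at [s = 0], where
   [A] does not depend on [t] and [cexpi] alone is integrated. *)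
{ apply (CInt_homotopy (fun s t => F (A s t) * (r * cexpi t * / (r * cexpi t - W)))%C
    (fun s t => dF (A s t) * (r * cexpi t))%C
    (fun s t => if Req_EM_T s 0 then dF (z0 + W) * r * cexpi t * / Ci
                else F (A s t) * / (Ci * s))%C (-1/4) (5/4)); try lra.
  - intros s t Hs; eapply cderive_eq.
    + apply cderive_mult; [|apply cderive_const].
      apply HF; [now apply DA|].
      unfold A; apply cderive_plus; [apply cderive_const|].
      apply cderive_mult; [apply cderive_RtoC|apply cderive_const].
    + simpl; field; apply NZ1.
  - intros s t Hs; apply ccont2_mult; [apply HC; [now apply DA|apply CA]|]; ccont.
  - intros s t Hs; apply ccont2_mult; [apply HC; [now apply DA|apply CA]|]; ccont.
    apply ccont2_inv; [unfold Cminus; ccont|apply NZ1].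
  - intros s t Hs; destruct (Req_EM_T s 0) as [->|Hs0].
    + eapply cderive_eq.
      * apply cderive_mult; [|apply cderive_const].
        apply cderive_mult; [apply cderive_const|apply cderive_cexpi].
      * unfold A; replace (z0 + W + 0 * (r * cexpi t - W))%C with (z0 + W)%C by ring.
        field; apply Ci_nz.
    + eapply cderive_eq.
      * apply cderive_mult; [|apply cderive_const].
        apply HF; [now apply DA|apply dA].
      * cbv beta; field; split; [|apply Ci_nz]; intros E; apply Hs0; now injection E.
  - intros s; unfold A; rewrite cexpi_2PI; reflexivity. }
assert (S2 : CInt (fun t => F (z0 + W)%C * (r * cexpi t * / (r * cexpi t - 1 * W)))%C =
  CInt (fun t => F (z0 + W)%C * (r * cexpi t * / (r * cexpi t - 0 * W)))%C).
(* At [s = 0] the kernel is constantly 1. Its [s]-derivative [r e^(it) W / (r e^(it) - s W)^2] is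
   the [t]-derivative of [i W / (r e^(it) - s W)]. *)
{ apply (CInt_homotopy (fun s t => F (z0 + W)%C * (r * cexpi t * / (r * cexpi t - s * W)))%C
    (fun s t => F (z0 + W)%C * (r * cexpi t * (W * (/ (r * cexpi t - s * W) * / (r * cexpi t - s * W)))))%C
    (fun s t => F (z0 + W)%C * (Ci * W * / (r * cexpi t - s * W)))%C (-3/2) (3/2)); try lra.
  - intros s t Hs; eapply cderive_eq.
    + apply cderive_mult; [apply cderive_const|].
      apply cderive_mult; [apply cderive_const|].
      apply cderive_inv; [|now apply NZ].
      apply cderive_plus; [apply cderive_const|].
      apply (cderive_ext (fun s => s * (- W))%C); [intros; ring|].
      apply cderive_mult; [apply cderive_RtoC|apply cderive_const].
    + simpl; field; now apply NZ.
  - intros s t Hs; ccont; apply ccont2_inv; try (now apply NZ);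
      apply (ccont2_ext (fun s t => r * cexpi t + s * (- W))%C); try (intros; ring); ccont.
  - intros s t Hs; ccont; apply ccont2_inv; try (now apply NZ);
      apply (ccont2_ext (fun s t => r * cexpi t + s * (- W))%C); try (intros; ring); ccont.
  - intros s t Hs; eapply cderive_eq.
    + apply cderive_mult; [apply cderive_const|].
      apply cderive_mult; [apply cderive_const|].
      apply cderive_inv; [|now apply NZ].
      apply cderive_plus; [|apply cderive_const].
      apply cderive_mult; [apply cderive_const|apply cderive_cexpi].
    + cbv beta; transitivity (- (Ci * Ci) * (F (z0 + W) * W * r * cexpi t /
        ((r * cexpi t - s * W) * (r * cexpi t - s * W))))%C; [field; now apply NZ|].
      rewrite Ci_sqr; field; now apply NZ.
  - intros s; rewrite cexpi_2PI; reflexivity. }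
transitivity (CInt (fun _ => F (z0 + W)%C)); [|apply CInt_const].
transitivity (CInt (fun t => F (A 1 t) * (r * cexpi t * / (r * cexpi t - W)))%C).
{ apply CInt_ext; intros t; unfold A; f_equal; f_equal; ring. }
rewrite S1.
transitivity (CInt (fun t => F (z0 + W)%C * (r * cexpi t * / (r * cexpi t - 1 * W)))%C).
{ apply CInt_ext; intros t; unfold A; rewrite Cmult_1_l; f_equal; f_equal; ring. }
rewrite S2.
apply CInt_ext; intros t; pose proof (NZ 0 t ltac:(lra)).
assert (E : (r * cexpi t - 0 * W = r * cexpi t)%C) by ring.
rewrite E in *; rewrite Cinv_r by exact H; ring.
Qed.

(** * Vanishing orders and smoothness of holomorphic functions *)

Definition partials (U : C -> Prop) (F Fx Fy : C -> C) : Prop :=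
  forall z, U z ->
    cderive (fun a => F (a, snd z)) (fst z) (Fx z) /\
    cderive (fun b => F (fst z, b)) (snd z) (Fy z).

(* [jet U z0 n p F]: [F] has iterated partial derivatives up to order [n] on
   [U], and those of order less than [p] (and at most [n]) vanish at [z0]. *)
Fixpoint jet (U : C -> Prop) (z0 : C) (n p : nat) (F : C -> C) : Prop :=
  ((0 < p)%nat -> F z0 = 0%C) /\
  match n with
  | O => True
  | S n => exists Fx Fy, partials U F Fx Fy /\
             jet U z0 n (pred p) Fx /\ jet U z0 n (pred p) Fy
  end.

Lemma jet_zero U z0 n p F : jet U z0 n p F -> (0 < p)%nat -> F z0 = 0%C.
Proof. destruct n; intros [H _]; exact H. Qed.

Lemma jet_weaken U z0 n p q F : (q <= p)%nat -> jet U z0 n p F -> jet U z0 n q F.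
Proof.
revert p q F; induction n as [|n IH]; intros p q F L [H1 H2]; split;
  try exact I; try (intros; apply H1; lia).
destruct H2 as (Fx & Fy & HP & HX & HY).
exists Fx, Fy; repeat split; try apply HP; try assumption;
  apply IH with (pred p); try assumption; lia.
Qed.

Lemma jet_pred U z0 n p F : jet U z0 (S n) p F -> jet U z0 n p F.
Proof.
revert p F; induction n as [|n IH]; intros p F [H1 H2]; split; try exact I; try exact H1.
destruct H2 as (Fx & Fy & HP & HX & HY).
exists Fx, Fy; split; [exact HP|split; apply IH; assumption].
Qed.

Lemma jet_vanish U z0 n F : jet U z0 n 0 F -> F z0 = 0%C -> jet U z0 n 1 F.
Proof. destruct n; intros [_ H] E; split; auto. Qed.

Lemma open_lines (U : C -> Prop) (z : C) : open U -> U z ->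
  locally (fst z) (fun a => U (a, snd z)) /\ locally (snd z) (fun b => U (fst z, b)).
Proof.
intros OU Uz; destruct (OU z Uz) as [e He]; split; exists e; intros x Hx;
  apply He; split; simpl; try exact Hx; apply ball_center.
Qed.

Lemma partials_ext (U : C -> Prop) (F G Fx Fy : C -> C) :
  open U -> (forall z, U z -> F z = G z) -> partials U F Fx Fy -> partials U G Fx Fy.
Proof.
intros OU E HP z Uz; destruct (HP z Uz) as [H1 H2], (open_lines U z OU Uz) as [L1 L2].
split; [apply cderive_ext_loc with (2 := H1) |
  apply cderive_ext_loc with (2 := H2)].
- apply filter_imp with (2 := L1); intros a; apply E.
- apply filter_imp with (2 := L2); intros b; apply E.
Qed.

Lemma jet_ext (U : C -> Prop) z0 n p (F G : C -> C) :
  open U -> U z0 -> (forall z, U z -> F z = G z) -> jet U z0 n p F -> jet U z0 n p G.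
Proof.
intros OU U0 E; destruct n as [|n]; intros [H1 H2]; split; try exact I;
  try (rewrite <- E by exact U0; exact H1).
destruct H2 as (Fx & Fy & HP & HX); exists Fx, Fy; split; [|exact HX].
now apply partials_ext with F.
Qed.

Lemma partials_const U a : partials U (fun _ => a) (fun _ => 0%C) (fun _ => 0%C).
Proof. intros z _; split; apply cderive_const. Qed.

Lemma partials_plus U F G Fx Fy Gx Gy :
  partials U F Fx Fy -> partials U G Gx Gy ->
  partials U (fun z => F z + G z)%C (fun z => Fx z + Gx z)%C (fun z => Fy z + Gy z)%C.
Proof. intros HF HG z Uz; split; apply cderive_plus; (apply HF || apply HG); exact Uz. Qed.

Lemma partials_mult U F G Fx Fy Gx Gy :
  partials U F Fx Fy -> partials U G Gx Gy ->
  partials U (fun z => F z * G z)%C (fun z => Fx z * G z + F z * Gx z)%C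
    (fun z => Fy z * G z + F z * Gy z)%C.
Proof.
intros HF HG z Uz; split; (eapply cderive_eq; [apply cderive_mult;
  [apply HF; exact Uz|apply HG; exact Uz]|]); destruct z; reflexivity.
Qed.

Lemma partials_Im U F Fx Fy : partials U F Fx Fy ->
  partials U (fun z => RtoC (Im (F z))) (fun z => RtoC (Im (Fx z)))
    (fun z => RtoC (Im (Fy z))).
Proof.
intros HF z Uz; destruct (HF z Uz) as [[_ H1] [_ H2]]; split; split; simpl;
  try assumption; exact (is_derive_const _ _).
Qed.

Lemma partials_id U : partials U (fun z => z) (fun _ => 1%C) (fun _ => Ci).
Proof.
intros z _; split; split; simpl; (exact (is_derive_id _) || exact (is_derive_const _ _)).
Qed.

Lemma partials_inv U (F Fx Fy : C -> C) : (forall z, U z -> F z <> 0%C) -> partials U F Fx Fy ->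
  partials U (fun z => / F z)%C (fun z => - Fx z / (F z * F z))%C
    (fun z => - Fy z / (F z * F z))%C.
Proof.
intros NZ HF z Uz; split; (eapply cderive_eq; [apply cderive_inv;
  [apply HF; exact Uz|destruct z; exact (NZ _ Uz)]|]); destruct z; reflexivity.
Qed.

Lemma jet_const0 U z0 n p : jet U z0 n p (fun _ => 0%C).
Proof.
revert p; induction n as [|n IH]; intros p; split; try reflexivity; try exact I.
exists (fun _ => 0%C), (fun _ => 0%C); split; [apply partials_const|split; apply IH].
Qed.

Lemma jet_const U z0 n a : jet U z0 n 0 (fun _ => a).
Proof.
destruct n as [|n]; split; try lia; try exact I.
exists (fun _ => 0%C), (fun _ => 0%C); split; [apply partials_const|split; apply jet_const0].
Qed.

Lemma jet_id U z0 n : jet U z0 n 0 (fun z => z).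
Proof.
destruct n as [|n]; split; try lia; try exact I.
exists (fun _ => 1%C), (fun _ => Ci); split; [apply partials_id|split; apply jet_const].
Qed.

Lemma jet_plus U z0 n p F G :
  jet U z0 n p F -> jet U z0 n p G -> jet U z0 n p (fun z => F z + G z)%C.
Proof.
revert p F G; induction n as [|n IH]; intros p F G [F1 F2] [G1 G2]; split; try exact I;
  try (intros L; rewrite F1, G1 by exact L; ring).
destruct F2 as (Fx & Fy & HF & HFx & HFy), G2 as (Gx & Gy & HG & HGx & HGy).
exists (fun z => Fx z + Gx z)%C, (fun z => Fy z + Gy z)%C.
split; [now apply partials_plus|split; apply IH; assumption].
Qed.

(** Leibniz's rule: each term of a partial derivative lowers the order of one factor only, so the
    total drops by at most one. [jet_pred] adapts the undifferentiated factor to the smaller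
    smoothness index. *)
Lemma jet_mult U z0 n p q F G :
  jet U z0 n p F -> jet U z0 n q G -> jet U z0 n (p + q) (fun z => F z * G z)%C.
Proof.
revert p q F G; induction n as [|n IH]; intros p q F G JF JG.
- destruct JF as [F1 _], JG as [G1 _]; split; [|exact I]; intros L.
  destruct p; [rewrite G1 by lia|rewrite F1 by lia]; ring.
- pose proof (jet_pred _ _ _ _ _ JF) as JF'; pose proof (jet_pred _ _ _ _ _ JG) as JG'.
  destruct JF as [F1 (Fx & Fy & HF & HFx & HFy)], JG as [G1 (Gx & Gy & HG & HGx & HGy)].
  split.
  { intros L; destruct p; [rewrite G1 by lia|rewrite F1 by lia]; ring. }
  exists (fun z => Fx z * G z + F z * Gx z)%C, (fun z => Fy z * G z + F z * Gy z)%C.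
  split; [now apply partials_mult|].
  split; apply jet_plus.
  + apply jet_weaken with (pred p + q)%nat; [lia|apply IH; assumption].
  + apply jet_weaken with (p + pred q)%nat; [lia|apply IH; assumption].
  + apply jet_weaken with (pred p + q)%nat; [lia|apply IH; assumption].
  + apply jet_weaken with (p + pred q)%nat; [lia|apply IH; assumption].
Qed.

Lemma jet_scal U z0 n p a F : jet U z0 n p F -> jet U z0 n p (fun z => a * F z)%C.
Proof. intros H; apply (jet_mult U z0 n 0 p); [apply jet_const|exact H]. Qed.

Lemma jet_smul U z0 n p F G :
  jet U z0 n p F -> jet U z0 n 0 G -> jet U z0 n p (fun z => F z * G z)%C.
Proof.
intros HF HG; apply jet_weaken with (p + 0)%nat; [lia|now apply jet_mult].
Qed.

(** [Im] is only real-linear, but it commutes with both real partial derivatives; this is why [jet]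
    is not phrased with complex derivatives. *)
Lemma jet_Im U z0 n p F : jet U z0 n p F -> jet U z0 n p (fun z => RtoC (Im (F z))).
Proof.
revert p F; induction n as [|n IH]; intros p F [F1 F2]; split; try exact I;
  try (intros L; rewrite F1 by exact L; reflexivity).
destruct F2 as (Fx & Fy & HF & HFx & HFy).
exists (fun z => RtoC (Im (Fx z))), (fun z => RtoC (Im (Fy z))).
split; [now apply partials_Im|split; apply IH; assumption].
Qed.

Lemma jet_inv U z0 n (F : C -> C) : (forall z, U z -> F z <> 0%C) ->
  jet U z0 n 0 F -> jet U z0 n 0 (fun z => / F z)%C.
Proof.
intros NZ; revert F NZ; induction n as [|n IH]; intros F NZ JF; split; try lia; try exact I.
pose proof (IH F NZ (jet_pred _ _ _ _ _ JF)) as JI.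
destruct JF as [_ (Fx & Fy & HF & HFx & HFy)].
(* The derivative of the inverse is written through [/ F] itself, so that the induction hypothesis
   at the lower index covers it. *)
exists (fun z => - (1) * Fx z * (/ F z * / F z))%C, (fun z => - (1) * Fy z * (/ F z * / F z))%C.
split.
- intros z Uz; destruct (partials_inv _ _ _ _ NZ HF z Uz) as [H1 H2].
  split; (eapply cderive_eq; [eassumption|]); cbv beta; field; now apply NZ.
- split; apply jet_smul; try (apply jet_scal; assumption); now apply jet_smul.
Qed.

Lemma jet_pow U z0 n p F : jet U z0 n 1 F -> jet U z0 n p (fun z => F z ^ p)%C.
Proof.
intros HF; induction p as [|p IH]; simpl; [apply jet_const|].
now apply (jet_mult U z0 n 1 p).
Qed.

Lemma jet_pow0 U z0 n p F : jet U z0 n 0 F -> jet U z0 n 0 (fun z => F z ^ p)%C.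
Proof.
intros HF; induction p as [|p IH]; simpl; [apply jet_const|].
now apply (jet_mult U z0 n 0 0).
Qed.

Lemma jet_sub_base U z0 n : jet U z0 n 1 (fun z => z - z0)%C.
Proof.
apply jet_vanish; [|ring]; apply (jet_plus U z0 n 0 (fun z => z) (fun _ => - z0)%C);
  [apply jet_id|apply jet_const].
Qed.

(** * Smoothness from the Cauchy kernel *)

Lemma cderive_pow (h : R -> C) (t : R) (a : C) (n : nat) : cderive h t a ->
  cderive (fun s => h s ^ S n)%C t (INR (S n) * h t ^ n * a)%C.
Proof.
intros H; induction n as [|n IH].
- apply cderive_ext with h; [intros s; simpl; ring|].
  eapply cderive_eq; [exact H|simpl; ring].
- apply cderive_ext with (fun s => h s * h s ^ S n)%C; [reflexivity|].
  eapply cderive_eq; [apply cderive_mult; [exact H|exact IH]|].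
  rewrite (S_INR (S n)), RtoC_plus; cbv beta; rewrite (Cpow_S (h t) n); ring.
Qed.

(** With a free density [h] this family is closed under differentiation: the exponent rises by one
    and the constants go into [h]. *)
Definition cauchy_kernel (r : R) (z0 : C) (h : R -> C) (n : nat) (w : C) : C :=
  CInt (fun t => h t * (/ (r * cexpi t - (w - z0))) ^ S n)%C.

(** The curve [g] has constant velocity [a], so that [a = 1] and [a = Ci] give the two partial
    derivatives. *)
Lemma cderive_cauchy_kernel (r : R) (z0 : C) (h : R -> C) (n : nat) (g : R -> C)
    (l m s : R) (a : C) :
  0 < r -> (forall t, ccont2 (fun _ v => h v) 0 t) ->
  l < s < m -> (forall u, l < u < m -> Cmod (g u - z0) < r) ->
  (forall u, l < u < m -> cderive g u a) ->
  (forall u v, l < u < m -> ccont2 (fun x _ => g x) u v) ->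
  cderive (fun u => cauchy_kernel r z0 h n (g u)) s
    (cauchy_kernel r z0 (fun t => a * (INR (S n) * h t))%C (S n) (g s)).
Proof.
intros Hr Hh Hs Hg Dg Cg; unfold cauchy_kernel.
assert (NZ : forall u t, l < u < m -> (r * cexpi t - (g u - z0))%C <> 0%C).
{ intros u t Hu; apply circle_minus_neq_0; [lra|now apply Hg]. }
assert (Ch : forall u t, ccont2 (fun _ v => h v) u t).
{ intros u t; destruct (Hh t) as [H1 H2].
  apply continuity_2d_pt_section in H1, H2; now apply ccont2_snd. }
assert (CK : forall u t, l < u < m ->
  ccont2 (fun u t => / (r * cexpi t - (g u - z0)))%C u t).
{ intros u t Hu; apply ccont2_inv; [|now apply NZ].
  apply (ccont2_ext (fun u t => r * cexpi t + - (1) * (g u + - z0))%C); [intros; ring|].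
  ccont; now apply Cg. }
apply (cderive_CInt (fun u t => h t * (/ (r * cexpi t - (g u - z0))) ^ S n)%C
  (fun u t => a * (INR (S n) * h t) * (/ (r * cexpi t - (g u - z0))) ^ S (S n))%C l m);
  try assumption.
- intros u t Hu; eapply cderive_eq.
  + apply cderive_mult; [apply cderive_const|].
    apply cderive_pow, cderive_inv; [|now apply NZ].
    apply cderive_plus; [apply cderive_const|].
    apply (cderive_ext (fun u => - (1) * (g u + - z0))%C); [intros; ring|].
    apply cderive_mult; [apply cderive_const|].
    apply cderive_plus; [now apply Dg|apply cderive_const].
  + cbv beta; rewrite !Cpow_S; field; now apply NZ.
- intros u t Hu; ccont; try apply Ch; apply CK, Hu.
- intros u t Hu; ccont; try apply Ch; apply CK, Hu.
Qed.

(** Here [ball] is an open square; 2 is a crude bound for the square root of 2. *)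
Lemma ball_Cmod (z0 z : C) (r : R) : ball z0 r z -> Cmod (z - z0) < 2 * r.
Proof.
intros [H1 H2]; unfold ball in H1, H2; simpl in H1, H2.
unfold AbsRing_ball, abs, minus, plus, opp in H1, H2; simpl in H1, H2.
replace (z - z0)%C with (RtoC (fst z + - fst z0) + Ci * RtoC (snd z + - snd z0))%C
  by (apply injective_projections; simpl; ring).
eapply Rle_lt_trans; [apply Cmod_triangle|].
rewrite Cmod_mult, !Cmod_R, Cmod_Ci; lra.
Qed.

Lemma Cmod_ball (z0 z : C) (r : R) : Cmod (z - z0) < r -> ball z0 r z.
Proof.
intros H; split; unfold ball; simpl; unfold AbsRing_ball, abs, minus, plus, opp; simpl;
  (eapply Rle_lt_trans; [|apply H]); (eapply Rle_trans; [|apply (Rmax_Cmod (z - z0)%C)]);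
  [apply Rmax_l|apply Rmax_r].
Qed.

Lemma cauchy_kernel_jet (r d : R) (z0 : C) (N : nat) : 0 < r -> 2 * d <= r ->
  forall (h : R -> C) (n : nat), (forall t, ccont2 (fun _ v => h v) 0 t) ->
  jet (ball z0 d) z0 N 0 (cauchy_kernel r z0 h n).
Proof.
intros Hr Hd; induction N as [|N IH]; intros h n Hh; split; try lia; try exact I.
exists (cauchy_kernel r z0 (fun t => 1 * (INR (S n) * h t))%C (S n)),
  (cauchy_kernel r z0 (fun t => Ci * (INR (S n) * h t))%C (S n)).
split; [|split; apply IH; intros t; ccont; apply Hh].
intros z Hz.
assert (B : forall w, ball z0 d w -> Cmod (w - z0) < r).
{ intros w Hw; apply ball_Cmod in Hw; lra. }
destruct Hz as [Hz1 Hz2].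
assert (E : forall c x, ball c d x <-> c - d < x < c + d).
{ intros c x; unfold ball; simpl; unfold AbsRing_ball, abs, minus, plus, opp; simpl.
  split; [intros Hx; apply Rabs_def2 in Hx; lra|intros Hx; apply Rabs_def1; lra]. }
split.
- replace (cauchy_kernel r z0 (fun t => 1 * (INR (S n) * h t))%C (S n) z) with
   (cauchy_kernel r z0 (fun t => 1 * (INR (S n) * h t))%C (S n) ((fun a => (a, snd z)) (fst z)))
   by (f_equal; destruct z; reflexivity).
  apply (cderive_cauchy_kernel r z0 h n (fun a => (a, snd z)) (fst z0 - d) (fst z0 + d));
    try assumption.
  + now apply E.
  + intros u Hu; apply B; split; [now apply E|exact Hz2].
  + intros u _; split; simpl; [exact (is_derive_id _)|exact (is_derive_const _ _)].
  + intros u v _; split; simpl; [apply continuity_2d_pt_id1|apply continuity_2d_pt_const].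
- replace (cauchy_kernel r z0 (fun t => Ci * (INR (S n) * h t))%C (S n) z) with
   (cauchy_kernel r z0 (fun t => Ci * (INR (S n) * h t))%C (S n) ((fun b => (fst z, b)) (snd z)))
   by (f_equal; destruct z; reflexivity).
  apply (cderive_cauchy_kernel r z0 h n (fun b => (fst z, b)) (snd z0 - d) (snd z0 + d));
    try assumption.
  + now apply E.
  + intros u Hu; apply B; split; [exact Hz1|now apply E].
  + intros u _; split; simpl; [exact (is_derive_const _ _)|exact (is_derive_id _)].
  + intros u v _; split; simpl; [apply continuity_2d_pt_const|apply continuity_2d_pt_id1].
Qed.

Lemma open_box (z0 : C) (r : R) : open (ball z0 r).
Proof.
intros z [H1 H2].
assert (O : forall c x : R, ball c r x -> locally x (ball c r)).
{ intros c x Hx; unfold ball in Hx |- *; simpl in Hx |- *.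
  unfold AbsRing_ball, abs, minus, plus, opp in Hx |- *; simpl in Hx |- *.
  assert (P : 0 < r - Rabs (x + - c)) by lra.
  exists (mkposreal _ P); intros y Hy.
  unfold ball in Hy; simpl in Hy; unfold AbsRing_ball, abs, minus, plus, opp in Hy; simpl in Hy.
  pose proof (Rabs_triang (y + - x) (x + - c)) as T.
  replace (y + - x + (x + - c)) with (y + - c) in T by ring; lra. }
destruct (O _ _ H1) as [e1 He1], (O _ _ H2) as [e2 He2].
assert (P : 0 < Rmin e1 e2) by (apply Rmin_pos; apply cond_pos).
exists (mkposreal _ P); intros w [W1 W2]; split; [apply He1|apply He2];
  (eapply ball_le; [|eassumption]); simpl; [apply Rmin_l|apply Rmin_r].
Qed.

(** Cauchy's formula on the circle of radius [4 * r]: points of the square lie within [2 * r] of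
    [z0], half that radius, and the disc of radius [8 * r], twice it, lies in the larger square. The
    formula makes [F] a multiple of the kernel of index 0. *)
Lemma holo_jet (D : C -> Prop) (F dF : C -> C) (z0 : C) (r : R) (n : nat) :
  holo D F dF -> 0 < r -> (forall z, ball z0 (8 * r) z -> D z) ->
  jet (ball z0 r) z0 n 0 F.
Proof.
intros HF Hr HD.
assert (P : RtoC (2 * PI) <> 0%C).
{ intros E; injection E; pose proof PI_RGT_0; lra. }
assert (HC : forall t, ccont2 (fun _ v => F (z0 + (4 * r)%R * cexpi v) * ((4 * r)%R * cexpi v))%C 0 t).
{ intros t; apply ccont2_mult; [|ccont].
  apply (proj2 HF); [|ccont].
  apply HD, Cmod_ball.
  replace (z0 + (4 * r)%R * cexpi t - z0)%C with ((4 * r)%R * cexpi t)%C by ring.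
  rewrite Cmod_mult, Cmod_cexpi, Cmod_R, Rabs_pos_eq by lra; lra. }
apply (jet_ext _ _ _ _ (fun z => / (2 * PI)%R * cauchy_kernel (4 * r) z0
  (fun t => F (z0 + (4 * r)%R * cexpi t) * ((4 * r)%R * cexpi t)) 0 z)%C).
- apply open_box.
- apply (ball_center z0 (mkposreal r Hr)).
- intros z Hz.
  assert (CF := Cauchy_formula D F dF z0 (z - z0)%C (4 * r) HF).
  replace (z0 + (z - z0))%C with z in CF by ring.
  transitivity (/ (2 * PI)%R * (2 * PI * F z))%C.
  + f_equal; rewrite <- CF; [|lra| |].
    * apply CInt_ext; intros t; simpl; ring.
    * apply ball_Cmod in Hz; lra.
    * intros w Hw; apply HD; apply Cmod_ball; lra.
  + rewrite RtoC_mult; rewrite RtoC_mult in P; field.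
    intros E; apply P; rewrite E; ring.
- apply jet_scal, cauchy_kernel_jet; try lra; exact HC.
Qed.

(** * Leading terms *)

Definition sph (F : C -> C) (z : C) : R := / snd z * Im (F z).

(* The action of [slice_derivative \o spherical_derivative] on one quaternionic
   component of a stem function. *)
Definition dzsph (F : C -> C) (z : C) : C :=
  (/ 2 * dx (sph F) z, / 2 * - dy (sph F) z).

Lemma dzsph_ext (F G : C -> C) : (forall z, F z = G z) -> forall z, dzsph F z = dzsph G z.
Proof.
intros E z; unfold dzsph, dx, dy, sph; f_equal; f_equal; [|f_equal];
  apply Derive_ext; intros t; now rewrite E.
Qed.

(** The coefficient [c] may be 0, since single coordinates of a nonzero stem value may vanish. All
    [n] are demanded because each application of [dzsph] consumes one derivative. *)
Definition leading (U : C -> Prop) (z0 : C) (p : nat) (c : C) (F : C -> C) : Prop :=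
  forall n, jet U z0 n (S p) (fun z => F z - c * (z - z0) ^ p)%C.

Lemma leading_0 U z0 c F : leading U z0 0 c F -> F z0 = c.
Proof.
intros H; assert (E := jet_zero _ _ _ _ _ (H 0%nat) (Nat.lt_0_succ _)); simpl in E.
rewrite <- (Cplus_0_r c), <- E; ring.
Qed.

Lemma leading_S U z0 p c F : leading U z0 (S p) c F -> F z0 = 0%C.
Proof.
intros H; assert (E := jet_zero _ _ _ _ _ (H 0%nat) (Nat.lt_0_succ _)); simpl in E.
rewrite <- E; ring.
Qed.

Lemma partials_RtoC (U : C -> Prop) (g : C -> R) (Gx Gy : C -> C) (z : C) :
  partials U (fun w => RtoC (g w)) Gx Gy -> U z ->
  RtoC (dx g z) = Gx z /\ RtoC (dy g z) = Gy z.
Proof.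
intros H Uz; destruct (H z Uz) as [[H1 H2] [H3 H4]].
apply is_derive_unique in H1, H2, H3, H4; simpl in *.
rewrite Derive_const in H2, H4.
split; apply injective_projections; simpl; unfold Re, Im in *; auto.
Qed.

Lemma partials_pow U (F Fx Fy : C -> C) (n : nat) : partials U F Fx Fy ->
  partials U (fun z => F z ^ S n)%C (fun z => INR (S n) * F z ^ n * Fx z)%C
    (fun z => INR (S n) * F z ^ n * Fy z)%C.
Proof.
intros HF z Uz; split; (eapply cderive_eq; [apply cderive_pow, HF, Uz|]);
  destruct z; reflexivity.
Qed.

(* [d/dz (Im F / beta)] is [F' / (2 i beta)] up to terms in [Im F], of higher order. *)
Lemma leading_dzsph (U : C -> Prop) (z0 : C) (p : nat) (c : C) (F : C -> C) :
  open U -> U z0 -> (forall z, U z -> snd z <> 0) ->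
  leading U z0 (S p) c F ->
  leading U z0 p (c * INR (S p) / (2 * Ci * snd z0))%C (dzsph F).
Proof.
intros OU U0 NZ HF n.
assert (NZC : forall z, U z -> RtoC (snd z) <> 0%C).
{ intros z Uz E; apply (NZ z Uz); now injection E. }
assert (JB : forall m, jet U z0 m 0 (fun z => / RtoC (snd z))%C).
{ intros m; apply jet_inv; [exact NZC|]; exact (jet_Im _ _ _ _ _ (jet_id U z0 m)). }
assert (PB : partials U (fun z => RtoC (snd z)) (fun _ => 0%C) (fun _ => 1%C)).
{ exact (partials_Im _ _ _ _ (partials_id U)). }
apply (partials_inv U (fun z => RtoC (snd z)) _ _ NZC) in PB.
(* [sph F] splits into [E1], of order [p + 2], and [Im M / beta] with the monomial [M] below, whose
   complex derivative is [A]. *)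
pose (E1 := fun z => (RtoC (Im (F z - c * (z - z0) ^ S p)) * / RtoC (snd z))%C).
assert (JE : jet U z0 (S n) (S (S p)) E1).
{ unfold E1; apply jet_smul; [apply jet_Im, HF|apply JB]. }
destruct JE as [_ (E1x & E1y & PE & JEx & JEy)]; simpl pred in JEx, JEy.
pose (A := fun z => (c * (INR (S p) * (z - z0) ^ p))%C).
assert (JA : jet U z0 n p A).
{ unfold A; do 2 apply jet_scal; apply jet_pow, jet_sub_base. }
pose (M := fun z => (c * (z - z0) ^ S p)%C).
assert (JM : jet U z0 n (S p) M).
{ unfold M; apply jet_scal, jet_pow, jet_sub_base. }
assert (PM : partials U M A (fun z => Ci * A z)%C).
{ assert (P0 : partials U (fun z => z - z0)%C (fun _ => 1 + 0)%C (fun _ => Ci + 0)%C).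
  { apply (partials_plus U (fun z => z) (fun _ => - z0)%C);
      [apply partials_id|apply partials_const]. }
  intros z Uz.
  destruct (partials_mult _ _ _ _ _ _ _ (partials_const U c) (partials_pow _ _ _ _ p P0) z Uz)
    as [H1 H2].
  split; (eapply cderive_eq; [eassumption|]); unfold A; ring. }
assert (PS : partials U (fun z => RtoC (sph F z))
  (fun z => E1x z + RtoC (Im (A z)) * / RtoC (snd z))%C
  (fun z => E1y z + (RtoC (Im (Ci * A z)) * / RtoC (snd z)
      - RtoC (Im (M z)) * (/ RtoC (snd z) * / RtoC (snd z))))%C).
{ pose proof (partials_plus _ _ _ _ _ _ _ PE
    (partials_mult _ _ _ _ _ _ _ (partials_Im _ _ _ _ PM) PB)) as PT.
  apply (partials_ext U (fun z => E1 z + RtoC (Im (M z)) * / RtoC (snd z))%C).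
  - exact OU.
  - intros z Uz; unfold E1, sph, M; pose proof (NZ z Uz).
    rewrite RtoC_mult, RtoC_inv by assumption.
    unfold Cminus; rewrite im_plus, im_opp, RtoC_plus, RtoC_opp; ring.
  - intros z Uz; destruct (PT z Uz) as [H1 H2]; pose proof (NZC z Uz).
    split; (eapply cderive_eq; [eassumption|]); cbv beta; field; assumption. }
(* The remainder has three sources, each of order [p + 1]: the derivatives of [E1], the derivative
   of [1 / beta] against [Im M], and the freezing of [1 / beta] at [z0], where the difference
   supplies the order that [A] lacks. *)
apply (jet_ext _ _ _ _ (fun z => (/ 2 * E1x z + (- Ci / 2) * E1y z)
  + ((Ci / 2) * (RtoC (Im (M z)) * (/ RtoC (snd z) * / RtoC (snd z)))
  + (- Ci / 2) * (A z * (/ RtoC (snd z) + - / RtoC (snd z0)))))%C).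
- exact OU.
- exact U0.
- intros z Uz; destruct (partials_RtoC _ _ _ _ _ PS Uz) as [X1 X2].
  assert (T : dzsph F z = (/ 2 * (RtoC (dx (sph F) z) - Ci * RtoC (dy (sph F) z)))%C).
  { unfold dzsph; apply injective_projections; simpl; field. }
  rewrite T, X1, X2.
  assert (TA : (RtoC (Im (Ci * A z)) + Ci * RtoC (Im (A z)))%C = A z).
  { apply injective_projections; simpl; unfold Re, Im; ring. }
  assert (K : (c * INR (S p) / (2 * Ci * snd z0) * (z - z0) ^ p)%C
     = ((- Ci / 2) * (A z * / RtoC (snd z0)))%C).
  { unfold A; transitivity ((- (Ci * Ci)) * (c * INR (S p) / (2 * Ci * snd z0) * (z - z0) ^ p))%C.
    - rewrite Ci_sqr; ring.
    - field; split; [|apply Ci_nz]; apply NZC, U0. }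
  rewrite K.
  set (a := RtoC (Im (A z))) in *; set (b := RtoC (Im (Ci * A z))) in *; rewrite <- TA.
  (* [field] treats [Ci] as an indeterminate; the two sides differ by a multiple of
     [1 + Ci * Ci]. *)
  match goal with |- _ = ?r =>
    transitivity (r - (1 + Ci * Ci) * (a * / RtoC (snd z) / 2))%C end;
    [field; split; apply NZC; assumption|rewrite Ci_sqr; ring].
- apply jet_plus; [apply jet_plus; apply jet_scal; assumption|apply jet_plus; apply jet_scal].
  + apply jet_smul; [now apply jet_Im|apply jet_smul; apply JB].
  + apply jet_weaken with (p + 1)%nat; [lia|].
    apply jet_mult; [exact JA|apply jet_vanish; [|ring]].
    apply (jet_plus _ _ _ _ (fun z => / RtoC (snd z))%C (fun _ => - / RtoC (snd z0))%C);
      [apply JB|apply jet_const].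
Qed.

(** Each step lowers the exponent [p + 1] to [p] and multiplies the coefficient by
    [(p + 1) / (2 i beta0)]; the numerators build the factorial. Before step [m] the exponent is
    still positive, hence the zeros. The induction peels off the innermost application, so [c] and
    [F] vary. *)
Lemma leading_iter (U : C -> Prop) (z0 : C) (m : nat) :
  open U -> U z0 -> (forall z, U z -> snd z <> 0) ->
  forall (c : C) (F : C -> C), leading U z0 m c F ->
  (forall k, (k < m)%nat -> Nat.iter k dzsph F z0 = 0%C) /\
  Nat.iter m dzsph F z0 = (c * INR (fact m) / (2 * Ci * snd z0) ^ m)%C.
Proof.
intros OU U0 NZ.
assert (N0 : (2 * Ci * snd z0)%C <> 0%C).
{ intros E; apply (NZ z0 U0); apply (f_equal snd) in E; simpl in E; lra. }
induction m as [|m IH]; intros c F HF.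
- split; [intros k Hk; lia|]; simpl; rewrite (leading_0 _ _ _ _ HF).
  field.
- destruct (IH _ _ (leading_dzsph _ _ _ _ _ OU U0 NZ HF)) as [H1 H2]; split.
  + intros [|k] Hk; [exact (leading_S _ _ _ _ _ HF)|].
    rewrite Nat.iter_succ_r; apply H1; lia.
  + rewrite Nat.iter_succ_r, H2.
    replace (fact (S m)) with (S m * fact m)%nat by reflexivity.
    rewrite mult_INR, RtoC_mult, Cpow_S; field.
    pose proof (Cpow_nz _ m N0).
    split; [assumption|].
    split; [|apply Ci_nz].
    intros E; apply (NZ z0 U0); now injection E.
Qed.

(** The cofactor [K] of [(z - z0)^m] may be replaced by its value at [z0], because [K - K z0]
    contributes one more order. *)
Lemma leading_quadratic_pow (U : C -> Prop) (z0 : C) (m : nat) (H : C -> C) :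
  (forall n, jet U z0 n 0 H) -> open U -> U z0 ->
  leading U z0 m ((2 * Ci * snd z0) ^ m * H z0)%C
    (fun z => ((z - z0) * (z - Cconj z0)) ^ m * H z)%C.
Proof.
intros JH OU U0 n.
pose (K := fun z => ((z - Cconj z0) ^ m * H z)%C).
assert (JK : jet U z0 n 0 K).
{ apply (jet_mult _ _ _ 0 0); [apply jet_pow0|apply JH].
  apply (jet_plus _ _ _ _ (fun z => z) (fun _ => - Cconj z0)%C);
    [apply jet_id|apply jet_const]. }
assert (E0 : ((2 * Ci * snd z0) ^ m * H z0)%C = K z0).
{ unfold K; f_equal; f_equal; apply injective_projections; simpl; ring. }
rewrite E0.
apply (jet_ext _ _ _ _ (fun z => (z - z0) ^ m * (K z + - K z0))%C); try assumption.
- intros z _; rewrite Cpow_mult_l; unfold K; ring.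
- apply jet_weaken with (m + 1)%nat; [lia|].
  apply jet_mult; [apply jet_pow, jet_sub_base|apply jet_vanish; [|ring]].
  apply (jet_plus _ _ _ _ K (fun _ => - K z0)%C); [exact JK|apply jet_const].
Qed.

(** * Slice functions and their stems *)

Ltac quat_ring := apply quat_ext; simpl; ring.

Lemma imag_unit_opp (I : quat) : imag_unit I -> imag_unit (- I)%Q.
Proof. intros H; unfold imag_unit; rewrite <- H; quat_ring. Qed.

Lemma qnorm_pos (x : quat) : 0 <= qnorm x.
Proof. apply sqrt_pos. Qed.

Lemma qnorm_sqr (x : quat) : qnorm x * qnorm x = qnorm2 x.
Proof. apply sqrt_sqrt; unfold qnorm2; nra. Qed.

Lemma qnorm2_mul (x y : quat) : qnorm2 (x * y)%Q = qnorm2 x * qnorm2 y.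
Proof. unfold qnorm2; simpl; ring. Qed.

Lemma qnorm2_eq0 (x : quat) : qnorm2 x = 0 -> x = qreal 0.
Proof. unfold qnorm2; intros H; apply quat_ext; simpl; nra. Qed.

Lemma qmul_eq0 (x y : quat) : (x * y)%Q = qreal 0 -> x = qreal 0 \/ y = qreal 0.
Proof.
intros H; assert (E : qnorm2 x * qnorm2 y = 0).
{ rewrite <- qnorm2_mul, H; unfold qnorm2; simpl; ring. }
destruct (Rmult_integral _ _ E); [left|right]; now apply qnorm2_eq0.
Qed.

Lemma qscal_eq0 (a : R) (x : quat) : a <> 0 -> qscal a x = qreal 0 -> x = qreal 0.
Proof.
intros Ha H; injection H as H0 H1 H2 H3.
apply quat_ext; simpl; apply (Rmult_eq_reg_l a); try assumption; lra.
Qed.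

Lemma qz_on_slice (I : quat) (z : C) :
  imag_unit I -> 0 < snd z -> qz (on_slice I z) = z /\ qdir (on_slice I z) = I.
Proof.
intros HI Hz; destruct (imag_unit_coords HI) as [I0 I1].
destruct z as [a b], I as [r p s t]; simpl in I0, I1, Hz; subst r.
assert (N : qnorm (qIm (on_slice (Quat 0 p s t) (a, b))) = b).
{ rewrite qIm_E; unfold qnorm, qnorm2; simpl.
  transitivity (sqrt (b * b)); [f_equal|apply sqrt_square; lra].
  replace (b * b) with ((p * p + s * s + t * t) * (b * b)) by (rewrite I1; ring); ring. }
split.
- unfold qz; rewrite N; f_equal; simpl; ring.
- unfold qdir; rewrite N; destruct (Req_EM_T b 0) as [E|_]; [lra|].
  rewrite qIm_E; apply quat_ext; simpl; field; lra.
Qed.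

Lemma qdir_spec (x : quat) : 0 < snd (qz x) ->
  imag_unit (qdir x) /\ x = on_slice (qdir x) (qz x).
Proof.
simpl; intros Hx; pose proof (qnorm_sqr (qIm x)) as N; rewrite qIm_E in N at 3.
unfold qnorm2 in N; simpl in N.
unfold qdir; destruct (Req_EM_T (qnorm (qIm x)) 0) as [E|_]; [lra|].
unfold on_slice, qz; simpl; rewrite (qIm_E x) at 2 4.
set (b := qnorm (qIm x)) in *; split.
- apply quat_ext; simpl; try ring; field_simplify; try lra.
  apply (Rmult_eq_reg_r (b ^ 2)); [|nra]; field_simplify; nra.
- destruct x as [r p s t]; simpl in *; apply quat_ext; simpl; field; lra.
Qed.

Lemma on_slice_conj (I : quat) (z : C) : on_slice I (Cconj z) = on_slice (- I)%Q z.
Proof. quat_ring. Qed.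

Lemma qconj_on_slice (I : quat) (z : C) :
  imag_unit I -> qconj (on_slice I z) = on_slice (- I)%Q z.
Proof.
intros HI; destruct (imag_unit_coords HI) as [I0 _].
apply quat_ext; simpl; rewrite I0; ring.
Qed.

Lemma on_slice_inj (I J : quat) (z : C) :
  0 < snd z -> on_slice I z = on_slice J z -> I = J.
Proof.
intros Hz E; injection E as E0 E1 E2 E3.
apply quat_ext; apply (Rmult_eq_reg_r (snd z)); lra.
Qed.

Definition qeval (I : quat) (u : quatC) : quat := (fst u + I * snd u)%Q.

(* Unlike in [slice_on_slice], no parity of [F] is needed: only points of [U],
   in the upper half-plane, are involved. *)
Definition induces (U : C -> Prop) (f : quat -> quat) (F : C -> quatC) : Prop :=
  forall I z, imag_unit I -> U z -> f (on_slice I z) = qeval I (F z).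

(** Above the real axis [beta] is invertible, and [qz] and [qdir] recover [z] and [I] from
    [on_slice I z]. *)
Definition upper (U : C -> Prop) : Prop := forall z, U z -> 0 < snd z.

Lemma slice_induces U F : upper U -> induces U (slice F) F.
Proof.
intros HU I z HI Uz; destruct (qz_on_slice I z HI (HU z Uz)) as [E1 E2].
unfold slice; now rewrite E1, E2.
Qed.

(** The value over [Cconj z], which lies outside the upper half-plane, is read as the value over [z]
    at the opposite unit. *)
Lemma stem_of_induced U f F z : induces U f F -> U z -> stem_of f z = F z.
Proof.
intros H Uz; unfold stem_of; rewrite on_slice_conj, !H; try assumption;
  try apply imag_unit_opp; try apply imag_unit_i.
unfold qeval; destruct (F z) as [u v]; f_equal; apply quat_ext; simpl; field.
Qed.

Lemma qinv_imag (I : quat) (b : R) : imag_unit I -> b <> 0 ->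
  qinv (qscal 2 (qIm (on_slice I (0, b)))) = qscal (/ (2 * b)) (- I)%Q.
Proof.
intros HI Hb; destruct (imag_unit_coords HI) as [I0 I1].
destruct I as [r p s t]; simpl in I0, I1; subst r.
rewrite qIm_E; unfold qinv, qnorm2; simpl.
match goal with |- qscal (/ ?n) _ = _ =>
  replace n with ((p * p + s * s + t * t) * (2 * b) ^ 2) by ring end.
rewrite I1; apply quat_ext; simpl; field; lra.
Qed.

Lemma spherical_derivative_induced U f F : upper U -> induces U f F ->
  induces U (spherical_derivative f) (fun z => (qscal (/ snd z) (snd (F z)), qreal 0)).
Proof.
intros HU H I z HI Uz; pose proof (HU z Uz) as Hz; unfold spherical_derivative.
rewrite qconj_on_slice, !H by (try apply imag_unit_opp; assumption).
replace (qIm (on_slice I z)) with (qIm (on_slice I (0, snd z)))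
  by (rewrite !qIm_E; quat_ring).
rewrite qinv_imag by (try assumption; lra).
transitivity (qscal (/ snd z) (- (I * I) * snd (F z))%Q).
- unfold qeval; apply quat_ext; simpl; field; lra.
- rewrite HI; quat_ring.
Qed.

Lemma qDerive_ext_loc (h k : R -> quat) (t : R) :
  locally t (fun s => h s = k s) -> qDerive h t = qDerive k t.
Proof.
intros E; apply quat_ext; simpl; apply Derive_ext_loc;
  apply filter_imp with (2 := E); intros s ->; reflexivity.
Qed.

Lemma d_z_ext (U : C -> Prop) (F G : C -> quatC) (z : C) :
  open U -> (forall w, U w -> F w = G w) -> U z -> d_z F z = d_z G z.
Proof.
intros OU E Uz; destruct (open_lines U z OU Uz) as [L1 L2].
assert (A : forall p : quatC -> quat, d_alpha (fun w => p (F w)) z = d_alpha (fun w => p (G w)) z).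
{ intros p; apply qDerive_ext_loc, filter_imp with (2 := L1); intros s Hs; now rewrite E. }
assert (B : forall p : quatC -> quat, d_beta (fun w => p (F w)) z = d_beta (fun w => p (G w)) z).
{ intros p; apply qDerive_ext_loc, filter_imp with (2 := L2); intros s Hs; now rewrite E. }
unfold d_z; cbv zeta; now rewrite (A fst), (A snd), (B fst), (B snd).
Qed.

Lemma slice_derivative_induced U h G : open U -> upper U -> induces U h G ->
  induces U (slice_derivative h) (d_z G).
Proof.
intros OU HU H I z HI Uz; unfold slice_derivative.
rewrite (slice_induces U _ HU I z HI Uz); unfold qeval.
rewrite (d_z_ext U (stem_of h) G z OU); try assumption; [reflexivity|].
intros w Uw; now apply (stem_of_induced U).
Qed.

Definition stem_dcs (F : C -> quatC) : C -> quatC :=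
  d_z (fun z => (qscal (/ snd z) (snd (F z)), qreal 0)).

Lemma dcs_iter_induced U f F k : open U -> upper U -> induces U f F ->
  induces U (dcs_iter k f) (Nat.iter k stem_dcs F).
Proof.
intros OU HU H; induction k as [|k IH]; [exact H|].
apply slice_derivative_induced, spherical_derivative_induced; assumption.
Qed.

(** * Coordinates of stems and complex scalars *)

Definition is_coord (c : quat -> R) : Prop := c = qr \/ c = qi \/ c = qj \/ c = qk.

(** The complexified quaternions as four copies of the complex numbers, [sqrt(-1)] becoming [Ci]. *)
Definition comp (c : quat -> R) (F : C -> quatC) (z : C) : C :=
  (c (fst (F z)), c (snd (F z))).

Lemma quatC_comp_ext (u v : quatC) :
  (forall c, is_coord c -> (c (fst u), c (snd u)) = (c (fst v), c (snd v)) :> C) -> u = v.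
Proof.
unfold is_coord; intros H.
assert (H1 := H qr ltac:(auto)); assert (H2 := H qi ltac:(auto)).
assert (H3 := H qj ltac:(auto)); assert (H4 := H qk ltac:(auto)).
injection H1; injection H2; injection H3; injection H4; intros.
apply injective_projections; apply quat_ext; assumption.
Qed.

Lemma comp_stem_dcs (c : quat -> R) (F : C -> quatC) (z : C) :
  is_coord c -> comp c (stem_dcs F) z = dzsph (comp c F) z.
Proof.
intros Hc; unfold comp, dzsph, dx, dy, sph, Im.
destruct Hc as [-> |[-> |[-> | ->]]]; simpl; rewrite !Derive_const; f_equal; ring.
Qed.

Lemma comp_iter_stem_dcs (c : quat -> R) (F : C -> quatC) (k : nat) :
  is_coord c ->
  forall z, comp c (Nat.iter k stem_dcs F) z = Nat.iter k dzsph (comp c F) z.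
Proof.
intros Hc; induction k as [|k IH]; intros z; [reflexivity|].
simpl; rewrite comp_stem_dcs by exact Hc; now apply dzsph_ext.
Qed.

Definition cact (w : C) (u : quatC) : quatC :=
  ((qscal (fst w) (fst u) - qscal (snd w) (snd u))%Q,
   (qscal (fst w) (snd u) + qscal (snd w) (fst u))%Q).

Lemma comp_cact (c : quat -> R) (w : C -> C) (F : C -> quatC) (z : C) : is_coord c ->
  comp c (fun z => cact (w z) (F z)) z = (w z * comp c F z)%C.
Proof.
intros [-> |[-> |[-> | ->]]]; unfold comp, cact, Cmult; simpl; f_equal; ring.
Qed.

(** [on_slice I w] commutes with [I]. Hence the pointwise product with a power of [Delta], whose
    stem is complex-valued, is a product of stems. *)
Lemma on_slice_qeval (I : quat) (w : C) (u : quatC) : imag_unit I ->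
  (on_slice I w * qeval I u)%Q = qeval I (cact w u).
Proof.
intros HI; unfold qeval, on_slice, cact; simpl.
transitivity (qscal (fst w) (fst u) + (I * I) * qscal (snd w) (snd u)
  + I * (qscal (fst w) (snd u) + qscal (snd w) (fst u)))%Q; [quat_ring|].
rewrite HI; quat_ring.
Qed.

Lemma on_slice_mul (I : quat) (w v : C) : imag_unit I ->
  (on_slice I w * on_slice I v)%Q = on_slice I (w * v)%C.
Proof.
intros HI; transitivity (qreal (fst w * fst v) + (I * I) * qreal (snd w * snd v)
  + I * qreal (fst w * snd v + snd w * fst v))%Q; [quat_ring|].
rewrite HI; quat_ring.
Qed.

Lemma qpow_on_slice (I : quat) (w : C) (n : nat) : imag_unit I ->
  qpow (on_slice I w) n = on_slice I (w ^ n)%C.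
Proof.
intros HI; induction n as [|n IH]; simpl; [quat_ring|].
now rewrite IH, on_slice_mul.
Qed.

(** The coefficients of [Delta] are real, so on every slice it is the complex quadratic with the
    same two conjugate roots. *)
Lemma Delta_on_slice (q I : quat) (z : C) : imag_unit I ->
  Defs.Delta q (on_slice I z) = on_slice I ((z - qz q) * (z - Cconj (qz q)))%C.
Proof.
intros HI; rewrite <- on_slice_mul by exact HI; unfold Defs.Delta.
replace (qnorm q ^ 2) with (qr q * qr q + qnorm (qIm q) * qnorm (qIm q)).
2:{ simpl; rewrite Rmult_1_r, !qnorm_sqr, qIm_E; unfold qnorm2; simpl; ring. }
set (b := qnorm (qIm q)).
transitivity (on_slice I z * on_slice I z - qscal 2 (on_slice I z * qreal (qr q))
  + qreal (qr q * qr q) - (I * I) * qreal (b * b))%Q.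
- rewrite HI; apply quat_ext; simpl; field.
- unfold qz; fold b; quat_ring.
Qed.

(** * Linear factors and their zeros on the sphere *)

Definition linear_stem (q : quat) (z : C) : quatC := ((qreal (fst z) - q)%Q, qreal (snd z)).

Definition linear_stems (qs : list quat) (G : C -> quatC) : C -> quatC :=
  fold_right (fun q H z => quatC_mul (linear_stem q z) (H z)) G qs.

Lemma linear_factors_induced U qs g G : upper U -> induces U g G ->
  induces U (linear_factors qs g) (linear_stems qs G).
Proof.
intros HU Hg; induction qs as [|q qs IH]; [exact Hg|].
intros I z HI Uz; simpl; unfold slice_mul.
rewrite (slice_induces U _ HU I z HI Uz).
rewrite (stem_of_induced U (fun x => x - q)%Q (linear_stem q) z);
  [|intros J w HJ Uw; quat_ring|exact Uz].
now rewrite (stem_of_induced U _ _ z IH Uz).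
Qed.

(** Multiplying by [x - q] multiplies each coordinate by [z] and adds a real combination of all
    four, with coefficients from a row of the matrix of left multiplication by [- q]. The induction
    therefore carries all coordinates together. *)
Lemma linear_stems_jet U z0 qs G : open U -> U z0 ->
  (forall c n, is_coord c -> jet U z0 n 0 (comp c G)) ->
  forall c n, is_coord c -> jet U z0 n 0 (comp c (linear_stems qs G)).
Proof.
intros OU U0 HG; induction qs as [|q qs IH]; [exact HG|].
set (H := linear_stems qs G) in *.
intros c n Hc.
assert (J : forall a b d e : R, jet U z0 n 0 (fun z =>
  z * comp c H z + (a * comp qr H z + (b * comp qi H z + (d * comp qj H z + e * comp qk H z))))%C).
{ intros a b d e; unfold is_coord in IH.
  apply jet_plus; [apply (jet_mult _ _ _ 0 0); [apply jet_id|now apply IH]|].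
  repeat apply jet_plus; apply jet_scal, IH; auto. }
destruct Hc as [-> |[-> |[-> | ->]]].
- apply (jet_ext _ _ _ _ _ _ OU U0) with (2 := J (- qr q) (qi q) (qj q) (qk q)).
  intros z _; apply injective_projections; simpl; fold H; ring.
- apply (jet_ext _ _ _ _ _ _ OU U0) with (2 := J (- qi q) (- qr q) (qk q) (- qj q)).
  intros z _; apply injective_projections; simpl; fold H; ring.
- apply (jet_ext _ _ _ _ _ _ OU U0) with (2 := J (- qj q) (- qk q) (- qr q) (qi q)).
  intros z _; apply injective_projections; simpl; fold H; ring.
- apply (jet_ext _ _ _ _ _ _ OU U0) with (2 := J (- qk q) (qj q) (- qi q) (- qr q)).
  intros z _; apply injective_projections; simpl; fold H; ring.
Qed.

Lemma holomorphic_stem_holo D G c : open D -> holomorphic_stem D G -> is_coord c ->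
  holo D (comp c G) (fun z => (dx (fun w => c (fst (G w))) z, dx (fun w => c (snd (G w))) z)).
Proof.
intros OD (H0 & H1 & CR) Hc.
apply (Cauchy_Riemann_holo D (fun w => c (fst (G w))) (fun w => c (snd (G w))) OD).
- unfold C1_quat in H0; destruct Hc as [-> |[-> |[-> | ->]]]; apply H0.
- unfold C1_quat in H1; destruct Hc as [-> |[-> |[-> | ->]]]; apply H1.
- intros z Dz; destruct (CR z Dz) as [E1 E2].
  apply (f_equal c) in E1, E2.
  destruct Hc as [-> |[-> |[-> | ->]]]; split; assumption.
Qed.

(** On the sphere of [p = alpha + J beta], the slice product of [x - p] with [h] has the value
    [beta (I - J) h(conj p)]. It vanishes at [p], and elsewhere only if [h] vanishes at [conj p];
    this is where conjugates of the roots enter. *)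
Lemma qeval_linear_stem (I J : quat) (z : C) (u : quatC) : imag_unit J ->
  qeval I (quatC_mul (linear_stem (on_slice J z) z) u)
    = qscal (snd z) ((I - J) * qeval (- J) u)%Q.
Proof.
intros HJ; destruct u as [u v]; unfold qeval, linear_stem, quatC_mul, on_slice; simpl.
transitivity (qscal (snd z) ((I - J) * u - (I * J) * v + (J * J) * v)%Q); [|quat_ring].
rewrite HJ; quat_ring.
Qed.

(** By [qeval_linear_stem] a zero other than the first root needs a zero of the remaining product at
    the conjugate of that root. By induction this would be the second root, contrary to the
    condition on neighbours. *)
Lemma linear_stems_qeval_eq0 (z : C) (qs : list quat) (G : C -> quatC) :
  0 < snd z ->
  (forall q, In q qs -> exists J, imag_unit J /\ q = on_slice J z) ->
  (forall i : nat, (S i < length qs)%nat ->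
     nth i qs (qreal 0) <> qconj (nth (S i) qs (qreal 0))) ->
  (forall I, imag_unit I -> qeval I (G z) <> qreal 0) ->
  forall I, imag_unit I ->
  qeval I (linear_stems qs G z) = qreal 0 <-> hd_error qs = Some (on_slice I z).
Proof.
intros Hz Hqs Hadj HG; induction qs as [|q qs IH]; intros I HI.
{ simpl; split; [intros E; now apply HG in E|discriminate]. }
destruct (Hqs q (or_introl eq_refl)) as (J & HJ & ->).
assert (IH' : forall I, imag_unit I ->
  qeval I (linear_stems qs G z) = qreal 0 <-> hd_error qs = Some (on_slice I z)).
{ apply IH; [intros q Hq; apply Hqs; now right|].
  intros i Hi; apply (Hadj (S i)); simpl; lia. }
simpl; rewrite qeval_linear_stem by exact HJ; split.
- intros E; apply qscal_eq0 in E; [|lra].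
  apply qmul_eq0 in E; destruct E as [E|E].
  + do 2 f_equal; injection E; intros; apply quat_ext; lra.
  + apply (IH' _ (imag_unit_opp J HJ)) in E.
    destruct qs as [|q qs]; [discriminate|]; injection E as ->.
    exfalso; apply (Hadj 0%nat); simpl; [lia|].
    rewrite <- qconj_on_slice by exact HJ; quat_ring.
- intros E; assert (E' : on_slice J z = on_slice I z) by congruence; clear E.
  apply on_slice_inj in E'; [|exact Hz].
  rewrite E'; quat_ring.
Qed.

(** * Multiplicities read off a factorization *)

Lemma slice_regular_stem D g : symmetric_open D -> slice_regular D g ->
  exists G, holomorphic_stem D G /\
    forall I z, imag_unit I -> D z -> g (on_slice I z) = qeval I (G z).
Proof.
intros HD (G & SG & HG & E); exists G; split; [exact HG|].
intros I z HI Dz; rewrite E; [exact (slice_on_slice z SG Dz HI)|].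
now exists z, I.
Qed.

(** Characterizes [m] by derivatives of [f] alone, for an arbitrary factorization, so that any two
    factorizations can be compared. *)
Lemma factorization_dcs_iter D f q0 m qs g :
  symmetric_open D -> circularization D q0 -> ~ is_real q0 ->
  factorization D f q0 m qs g ->
  (forall k, (k < m)%nat -> dcs_iter k f q0 = qreal 0 /\
     spherical_derivative (dcs_iter k f) q0 = qreal 0) /\
  (dcs_iter m f q0 = qreal 0 <-> hd_error qs = Some q0) /\
  ~ (dcs_iter m f q0 = qreal 0 /\ spherical_derivative (dcs_iter m f) q0 = qreal 0).
Proof.
intros HD Hq0 Hreal (Hsph & Hadj & Hg & Hg0 & Hf).
set (z0 := qz q0).
assert (Hz0 : 0 < snd z0).
{ simpl; destruct (Rle_lt_or_eq_dec _ _ (qnorm_pos (qIm q0))) as [|E]; [assumption|].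
  exfalso; apply Hreal; exists (qr q0).
  pose proof (qnorm_sqr (qIm q0)) as N; rewrite <- E, qIm_E in N; unfold qnorm2 in N; simpl in N.
  apply quat_ext; simpl; nra. }
destruct (qdir_spec q0 Hz0) as [HI Eq0]; fold z0 in Eq0.
set (I0 := qdir q0) in *.
assert (Dz0 : D z0).
{ destruct Hq0 as (z & J & Dz & HJ & E).
  destruct (Rtotal_order (snd z) 0) as [L|[E0|L]].
  (* Membership in the circularization may be witnessed by a point below the real axis; conjugating
     it and changing the sign of [J] leaves [q0] fixed. *)
  - assert (L' : 0 < snd (Cconj z)) by (simpl; lra).
    rewrite <- (Cconj_conj z), on_slice_conj in E.
    destruct (qz_on_slice _ _ (imag_unit_opp J HJ) L') as [Ez _].
    unfold z0; rewrite E, Ez; exact (proj1 (proj2 HD z) Dz).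
  - exfalso; apply Hreal; exists (fst z); rewrite E; apply quat_ext; simpl; rewrite E0; ring.
  - destruct (qz_on_slice _ _ HJ L) as [Ez _]; unfold z0; now rewrite E, Ez. }
destruct (slice_regular_stem D g HD Hg) as (G & HG & EG).
destruct (proj1 HD z0 Dz0) as [e He].
(* The first bound keeps the square above the real axis, the second provides the room that
   [holo_jet] requires. *)
set (r := Rmin (snd z0) (e / 8)).
assert (Hr : 0 < r) by (apply Rmin_pos; [exact Hz0|pose proof (cond_pos e); lra]).
assert (HrD : forall z, ball z0 (8 * r) z -> D z).
{ intros z Hz; apply He; eapply ball_le; [|exact Hz].
  pose proof (Rmin_r (snd z0) (e / 8)); fold r in H; lra. }
set (U := ball z0 r : C -> Prop).
assert (OU : open U) by apply open_box.
assert (U0 : U z0) by apply (ball_center z0 (mkposreal r Hr)).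
assert (UD : forall z, U z -> D z).
{ intros z Uz; apply HrD; eapply ball_le; [|exact Uz]; lra. }
assert (UU : upper U).
{ intros z [_ Hz]; unfold ball in Hz; simpl in Hz.
  unfold AbsRing_ball, abs, minus, plus, opp in Hz; simpl in Hz.
  apply Rabs_def2 in Hz; pose proof (Rmin_l (snd z0) (e / 8)) as L; fold r in L; simpl in *; lra. }
assert (NZ : forall z, U z -> snd z <> 0) by (intros z Uz; pose proof (UU z Uz); lra).
set (H := linear_stems qs G).
assert (JH : forall c n, is_coord c -> jet U z0 n 0 (comp c H)).
{ apply linear_stems_jet; try assumption; intros c n Hc.
  exact (holo_jet D _ _ z0 r n (holomorphic_stem_holo D G c (proj1 HD) HG Hc) Hr HrD). }
set (F := fun z => cact (((z - z0) * (z - Cconj z0)) ^ m)%C (H z)).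
assert (HF : induces U f F).
{ intros I z HIz Uz; rewrite Hf by (exists z, I; auto).
  rewrite Delta_on_slice, qpow_on_slice by exact HIz.
  rewrite (linear_factors_induced U qs g G UU) by (try assumption; intros J w HJ Uw; auto).
  now apply on_slice_qeval. }
assert (TF : forall c, is_coord c ->
  (forall k, (k < m)%nat -> comp c (Nat.iter k stem_dcs F) z0 = 0%C) /\
  comp c (Nat.iter m stem_dcs F) z0 = (INR (fact m) * comp c H z0)%C).
{ intros c Hc.
  assert (LF : leading U z0 m ((2 * Ci * snd z0) ^ m * comp c H z0)%C (comp c F)).
  { intros n; eapply jet_ext with (4 := leading_quadratic_pow U z0 m _ (fun n => JH c n Hc) OU U0 n);
      try assumption.
    intros z _; unfold F; now rewrite comp_cact. }
  destruct (leading_iter U z0 m OU U0 NZ _ _ LF) as [L1 L2]; split.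
  - intros k Hk; rewrite comp_iter_stem_dcs by exact Hc; now apply L1.
  - rewrite comp_iter_stem_dcs, L2 by exact Hc; field.
    apply Cpow_nz; intros E; apply (f_equal snd) in E; simpl in E, Hz0; lra. }
assert (V : forall k, dcs_iter k f q0 = qeval I0 (Nat.iter k stem_dcs F z0) /\
  spherical_derivative (dcs_iter k f) q0 = qscal (/ snd z0) (snd (Nat.iter k stem_dcs F z0))).
{ intros k; pose proof (dcs_iter_induced U f F k OU UU HF) as Hk.
  rewrite Eq0; split; [now apply Hk|].
  rewrite (spherical_derivative_induced U _ _ UU Hk) by assumption; quat_ring. }
assert (EH : forall I, imag_unit I ->
  qeval I (H z0) = qreal 0 <-> hd_error qs = Some (on_slice I z0)).
{ apply linear_stems_qeval_eq0; try assumption.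
  intros I HIz; rewrite <- EG by assumption; apply Hg0; now exists I. }
assert (Em : Nat.iter m stem_dcs F z0 = cact (INR (fact m)) (H z0)).
{ apply quatC_comp_ext; intros c Hc.
  change (comp c (Nat.iter m stem_dcs F) z0 = comp c (fun z => cact (INR (fact m)) (H z)) z0).
  rewrite comp_cact by exact Hc; now apply TF. }
assert (Nm : INR (fact m) <> 0) by apply INR_fact_neq_0.
destruct (V m) as [V1 V2]; rewrite V1, V2, Em.
assert (E1 : qeval I0 (cact (INR (fact m)) (H z0)) = qscal (INR (fact m)) (qeval I0 (H z0)))
  by quat_ring.
rewrite E1; split; [|split].
- intros k Hk; destruct (V k) as [-> ->].
  assert (Z : Nat.iter k stem_dcs F z0 = (qreal 0, qreal 0)).
  { apply quatC_comp_ext; intros c Hc.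
    transitivity (RtoC 0); [now apply TF|].
    destruct Hc as [-> |[-> |[-> | ->]]]; reflexivity. }
  rewrite Z; split; quat_ring.
- rewrite Eq0, <- EH by exact HI; split; [now apply qscal_eq0|intros ->; quat_ring].
- intros [Z1 Z2]; apply qscal_eq0 in Z1; [|exact Nm].
  apply qscal_eq0 in Z2; [|apply Rinv_neq_0_compat; lra].
  (* With [F1 = 0] the value no longer depends on the unit, so [H] would vanish at both [q0] and its
     conjugate, and the first root would equal both. *)
  assert (Z3 : snd (H z0) = qreal 0).
  { apply (qscal_eq0 (INR (fact m))); [exact Nm|]; rewrite <- Z2; quat_ring. }
  assert (Z4 : qeval (- I0) (H z0) = qreal 0).
  { rewrite <- Z1; unfold qeval; rewrite Z3; quat_ring. }
  apply (EH _ HI) in Z1; apply (EH _ (imag_unit_opp I0 HI)) in Z4.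
  assert (E : I0 = (- I0)%Q) by (apply (on_slice_inj _ _ z0 Hz0); congruence).
  destruct (imag_unit_coords HI) as [_ N].
  pose proof (f_equal qi E) as E2; pose proof (f_equal qj E) as E3; pose proof (f_equal qk E) as E4.
  simpl in E2, E3, E4; nra.
Qed.

Theorem corollary4p3 (D : C -> Prop) (f : quat -> quat) (q0 : quat) (n : nat)
  (hD : symmetric_open D)
  (hf : slice_regular D f)
  (hq0 : circularization D q0)
  (hq0_nonreal : ~ is_real q0)
  (hfact : exists m qs g, factorization D f q0 m qs g)
  (hvanish : forall k : nat, (k < n)%nat ->
     dcs_iter k f q0 = qreal 0 /\
     spherical_derivative (dcs_iter k f) q0 = qreal 0)
  (hnonzero : dcs_iter n f q0 <> qreal 0 \/
     spherical_derivative (dcs_iter n f) q0 <> qreal 0) :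
  unique (spherical_multiplicity D f q0) (2 * n)%nat /\
  (forall k : nat, isolated_multiplicity D f q0 k ->
     ((0 < k)%nat <-> dcs_iter n f q0 = qreal 0)).
Proof.
(* If [m < n], the vanishing assumed below [n] contradicts nonvanishing at [m]; if [n < m],
   vanishing below [m] contradicts nonvanishing at [n]. *)
assert (Hm : forall m qs g, factorization D f q0 m qs g -> m = n).
{ intros m qs g Hfac.
  destruct (factorization_dcs_iter D f q0 m qs g hD hq0 hq0_nonreal Hfac) as (H1 & _ & H3).
  destruct (Nat.lt_trichotomy m n) as [L|[E|L]]; [|exact E|]; exfalso.
  - exact (H3 (hvanish m L)).
  - destruct (H1 n L); tauto. }
split; [split|].
- destruct hfact as (m & qs & g & Hfac); exists m, qs, g; split; [exact Hfac|].
  now rewrite (Hm _ _ _ Hfac).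
- intros s (m & qs & g & Hfac & ->); now rewrite (Hm _ _ _ Hfac).
- intros k (m & qs & g & Hfac & Hk).
  (* The isolated multiplicity may come from a different factorization, but its exponent is again
     [n], so the criterion on the first root applies to the [n]-th iterate. *)
  destruct (factorization_dcs_iter D f q0 m qs g hD hq0 hq0_nonreal Hfac) as (_ & H2 & _).
  rewrite (Hm _ _ _ Hfac) in H2; rewrite H2.
  destruct Hk as [[E ->]|[E ->]].
  + split; [now intros _|intros _]; destruct qs; [discriminate|simpl; lia].
  + split; [lia|now intros].
Qed.
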